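(* Suppose $0<p\le n-p$. Then, for $\mu=[p,n-p]$ and for any $\mu\vdash n$ with $\min(\mu)\ge p+1$, every zero of the genus distribution polynomial $P^{\bullet}_{[p,n-p],\mu}(x)$ has real part $0$.
   Context: Here $n,p$ are integers. $\mathfrak{S}_n$ is the symmetric group on $[n]=\{1,\ldots,n\}$; for a partition $\lambda\vdash n$, $\mathcal{C}_\lambda\subset\mathfrak{S}_n$ is the conjugacy class of permutations of cycle-type $\lambda$; $[p,n-p]$ denotes the partition of $n$ with the two parts $p$ and $n-p$; $\min(\mu)$ is the smallest part of $\mu$; $\kappa(\pi)$ is the number of cycles of the permutation $\pi$ (fixed points included). For $\mu\vdash n$ and a fixed permutation $\gamma\in\mathfrak{S}_n$ of cycle-type $[p,n-p]$, $$P^{\bullet}_{[p,n-p],\mu}(x)=\frac{1}{|\mathcal{C}_\mu|}\sum_{\alpha\in\mathcal{C}_\mu,\ \langle\alpha,\gamma\rangle\text{ transitive on }[n]}x^{\kappa(\alpha\gamma)},$$ which does not depend on the choice of $\gamma$.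
   Formalization: The single case n = 2, p = 1, μ = [1,1] is excluded: there α = γ = id is not transitive, so the genus distribution polynomial is identically 0 and every complex number is a zero. *)

(* Defs.v *)
From mathcomp Require Import all_boot all_order all_algebra all_fingroup.
From mathcomp Require Import reals complex.

Set Implicit Arguments.
Unset Strict Implicit.
Unset Printing Implicit Defensive.

Import GRing.Theory.

Local Open Scope nat_scope.

(* Partitions are lists of positive parts in weakly decreasing order. *)
Definition is_partition (n : nat) (mu : seq nat) : bool :=
  [&& sorted geq mu, all (leq 1) mu & sumn mu == n].

(* Meaningful for nonempty mu; equal to 0 on the empty list. *)
Definition min_part (mu : seq nat) : nat := foldr minn (head 0 mu) mu.

(* [p, n - p], listed in decreasing order under the assumption p <= n - p. *)
Definition two_parts (n p : nat) : seq nat := [:: n - p; p].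

(* 'I_n plays the role of {1, ..., n}; porbits s is the set of cycles of s,
   fixed points included. *)
Definition kappa (n : nat) (s : 'S_n) : nat := #|porbits s|.

Definition cycle_type (n : nat) (s : 'S_n) : seq nat :=
  sort geq (map (fun C : {set 'I_n} => #|C|) (enum (porbits s))).

Definition cycle_class (n : nat) (mu : seq nat) : {set 'S_n} :=
  [set s : 'S_n | cycle_type s == mu].

Definition generates_transitive (n : nat) (s t : 'S_n) : bool :=
  [transitive <<[set s; t]>>%g, on [set: 'I_n] | 'P].

(* The group law of 'S_n composes from left to right; alpha * gamma and
   gamma * alpha are conjugate, so kappa does not depend on the convention. *)
Definition genus_poly (n : nat) (gamma : 'S_n) (mu : seq nat) : {poly rat} :=
  (((#|cycle_class n mu|)%:R)^-1 *:
    \sum_(alpha in cycle_class n mu | generates_transitive alpha gamma)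
      'X^(kappa (alpha * gamma)%g))%R.

(* Main.v *)
Require Import Defs.
From mathcomp Require Import all_boot all_order all_algebra all_fingroup.
From mathcomp Require Import reals complex.
From mathcomp Require Import all_field all_character zify ring lra.
From mathcomp Require Import mpoly.

(** Let [q = n - p], let [gamma] have cycle type [q, p], and let [E] be the shift
[(E f)(x) = f(x - 1)].  The theorem rests on the closed formula
[[
  n! P(x) = \sum_(r < p) F(x + r),
  F(x) = x (x - 1) ... (x - p + 1) * \prod_i (1 - E^(mu_i)) (x + 1) ... (x + q)
]]
([genus_poly_numerator]), from which the position of the zeros can be read off.

_The formula._  At a positive integer [N] the number [N ^ kappa s] counts the
colourings of the points by [N] colours that [s] fixes.  Let [delta] be
[(0, ..., N - 1)], let [Delta] be the Vandermonde polynomial in [N] variables and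
[p_s] the product of the power sums whose degrees are the cycle lengths of [s].
When the entries of [a] are distinct and have the right sum, the coefficient
[chi_a(s)] of [z^a] in [p_s Delta] is, up to sign, an irreducible character of the
symmetric group, and for [N >= n] all irreducible characters arise so
([alt_char_irr], [irr_is_alt_char]).  Hence
convolution with the class function [N ^ kappa] multiplies [chi_a] by a scalar;
comparing values at the identity, the scalar is [\prod_i a_i! / i!]
([alt_char_convolution]).  Expanding the indicator of a conjugacy class in the
[chi_a] gives the sum of [N ^ kappa(alpha u^-1)] over [u] in a class as a weighted
sum of values [chi_a(alpha)] ([class_sum_fixcount]).

For the class of [gamma] the [a] that occur are obtained from [delta], seen as the
positions of [N] particles, by raising one particle [i] by [p] and then one
particle by [q], with weights [(i + 1) ... (i + p)] and similarly for [q].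
Evaluating [chi_a] at [alpha] of cycle type [mu] means lowering particles by the
parts of [mu] until the positions are those of [delta] again; configurations in
which two particles meet or one becomes negative cancel or vanish.  Commuting the
lowering operators past the operator that raises by [q] ([weighted_lower]) leaves a
single term for each of the [p] topmost particles when every part exceeds [p]: no
part can bring the particle raised by [p] back, so all parts must act on the move
by [q], turning its weight [(x + 1) ... (x + q)] into the iterated difference in
[F].  A permutation with all cycles longer than [p] never preserves a cycle of
[gamma], so the transitivity condition is then automatic.  For [mu] of type [q, p]
one more term survives, two if [p = q]; they factor into one-cycle sums and are
exactly the contribution of the [alpha] that preserve both cycles of [gamma]
([disconnected_sum]), i.e. of the non-transitive ones.

_The zeros._  Call a polynomial aligned when its zeros are [L] consecutive real
numbers [c - (L - 1)/2, ..., c + (L - 1)/2] together with numbers of real part [c].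
If [theta] has modulus one and [f] is aligned, then [f - theta E f], unless it is 0,
is aligned with [L - 1] instead of [L] (or still 0) and [c + 1/2] instead of [c]
([aligned_step]): off the line [Re x = c + 1/2] the two terms have different
moduli, after the common zeros are removed.  The polynomials [1 - E^m] and
[1 + E + ... + E^(p - 1)] in [E] have all their roots on the unit circle, so they
are products of such steps.  Starting from [(x + 1) ... (x + q)], with [L = q] and
[c = - (q + 1)/2], the [n = p + q] steps of [\prod_i (1 - E^(mu_i))] lead to
[L = 0] and [c = (p - 1)/2]; this is also the centre of the zeros
[0, ..., p - 1] of the other factor of [F], so [F] is aligned with [L = p].  After
a translation by [p - 1], the [p - 1] steps of the last sum end with [L = 1] and
[c = 0]: all zeros have real part 0 ([genus_numerator_zeros]). *)

Set Implicit Arguments.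
Unset Strict Implicit.
Unset Printing Implicit Defensive.

Import Order.TTheory GRing.Theory Num.Theory.
Local Open Scope ring_scope.

(** * Colourings fixed by a permutation *)
Section Colourings.
Variables (T I : finType).
Implicit Types (s : {perm T}) (f : {ffun T -> I}) (m : {ffun I -> nat}).

Definition fixes s f := [forall x, f (s x) == f x].

Definition content f : {ffun I -> nat} := [ffun i => #|[set x | f x == i]|].

Definition recolour f s : {ffun T -> I} := [ffun x => f ((s^-1)%g x)].

Lemma recolour_act : is_action [set: {perm T}] recolour.
Proof.
apply: is_total_action => [f|f s t]; apply/ffunP=> x; rewrite !ffunE.
  by rewrite invg1 perm1.
by rewrite invMg permM.
Qed.

(** Colourings with a given content form one orbit of this action
([content_orbit]), so fixed colourings can be counted by the Cauchy-Frobenius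
lemma. *)
Canonical recolour_action := Action recolour_act.

Lemma recolour_fixes f s : (recolour f s == f) = fixes s f.
Proof.
apply/eqP/forallP => [h x|h].
  by rewrite -{1}h ffunE permK.
by apply/ffunP=> x; rewrite ffunE -{2}[x](permKV s) (eqP (h _)).
Qed.

Lemma content_recolour f s : content (recolour f s) = content f.
Proof.
apply/ffunP=> i; rewrite !ffunE.
rewrite -(card_imset [set x | f x == i] (@perm_inj _ s)).
apply: eq_card => x; rewrite inE ffunE; apply/idP/imsetP => [h|[y]].
  by exists ((s^-1)%g x); rewrite ?inE // permKV.
by rewrite inE => h ->; rewrite permK.
Qed.

Lemma sum_content f : (\sum_i content f i = #|T|)%N.
Proof.
rewrite -sum1_card (partition_big f predT) //=.
by apply: eq_bigr => i _; rewrite ffunE -sum1_card; apply: eq_bigl => x; rewrite inE.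
Qed.

Lemma content_fgraph f i : content f i = count_mem i (fgraph f).
Proof.
rewrite ffunE -sum1_card -sum1_count -codom_ffun big_map big_enum_cond /=.
by apply: eq_bigl => x; rewrite inE.
Qed.

(** Write down [m i] copies of each colour [i], in any order. *)
Lemma content_exists m : (\sum_i m i = #|T|)%N -> exists f, content f = m.
Proof.
move=> hm.
pose w := flatten [seq nseq (m i) i | i <- enum I].
have hw : size w == #|T|.
  rewrite size_flatten /shape -map_comp sumnE big_map big_enum /= -hm.
  by apply/eqP/eq_bigr => i _; rewrite size_nseq.
exists (Finfun (Tuple hw)); apply/ffunP => i.
rewrite content_fgraph FinfunK /= /w count_flatten -map_comp sumnE big_map big_enum /=.
rewrite (bigD1 i) //= count_nseq /= eqxx mul1n big1 ?addn0 // => j hj.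
by rewrite count_nseq /= (negbTE hj).
Qed.

(** Two words with the same letters differ by a permutation of positions. *)
Lemma content_orbit f f' : content f = content f' -> exists s, f' = recolour f s.
Proof.
move=> h.
have /tuple_permP[p hp] : perm_eq (fgraph f) (fgraph f').
  by apply/allP=> i _ /=; rewrite -!content_fgraph h.
have hp' x : f x = f' (enum_val (p (enum_rank x))).
  have /(congr1 (fun t => tnth t (enum_rank x))) := val_inj hp.
  by rewrite tnth_mktuple !tnth_fgraph enum_rankK.
have ip : injective (fun x : T => enum_val (p (enum_rank x))).
  by move=> x y /enum_val_inj/perm_inj/enum_rank_inj.
exists (perm ip); apply/ffunP=> x; rewrite ffunE hp'.
by congr (f' _); rewrite -[LHS](permKV (perm ip)) permE.
Qed.

End Colourings.

Lemma card_permT (T : finType) : #|[set: {perm T}]| = #|T|`!.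
Proof.
rewrite -[in RHS]cardsT -card_perm; apply: eq_card => s.
by rewrite inE unfold_in; apply/esym/subsetP => x.
Qed.

(** The Cauchy-Frobenius lemma for the single orbit of colourings with content
[m]. *)
Lemma sum_fixes_content (T I : finType) (m : {ffun I -> nat}) :
    (\sum_i m i = #|T|)%N ->
  (\sum_(s : {perm T}) #|[set f : {ffun T -> I} | fixes s f & content f == m]|
    = #|T|`!)%N.
Proof.
move=> hm; pose S := [set f : {ffun T -> I} | content f == m].
have actS : [acts [set: {perm T}], on S | @recolour_action T I].
  apply/actsP=> s _ f; rewrite /= /S !inE /=.
  by rewrite content_recolour.
have := Frobenius_Cauchy actS; rewrite card_permT => h.
have -> : (\sum_(s : {perm T}) #|[set f : {ffun T -> I} | fixes s f & content f == m]|
    = \sum_(s in [set: {perm T}]) #|('Fix_(S | @recolour_action T I)[s])%g|)%N.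
  apply: eq_big => [s|s _]; first by rewrite inE.
  apply: eq_card => f.
  by rewrite !inE sub1set !inE /= recolour_fixes andbC.
rewrite h -[RHS]mul1n; congr (_ * _)%N.
have [f0 hf0] := content_exists hm.
apply/eqP/cards1P; exists S; apply/setP=> O; rewrite inE; apply/imsetP/eqP.
  case=> f; rewrite inE => /eqP hf ->; apply/setP => g; rewrite inE.
  apply/orbitP/eqP => [[s _ <-]|hg].
    by rewrite /= content_recolour.
  have [s hs] := content_orbit (etrans hf (esym hg)).
  by exists s => //=; rewrite inE.
move=> ->; exists f0; rewrite ?inE ?hf0 //; apply/setP => g; rewrite inE.
apply/eqP/orbitP => [hg|[s _ <-]].
  have [s hs] := content_orbit (etrans hf0 (esym hg)).
  by exists s => //=; rewrite inE.
by rewrite /= content_recolour.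
Qed.

(** Only the content of a colouring enters [W], so the double sum groups by
contents, each of which is counted [#|T|`!] times by [sum_fixes_content].  The bound
[K] serves to let the contents range over a finite type. *)
Lemma sum_fixes (T I : finType) (V : nmodType) (K : nat)
    (W : {ffun I -> nat} -> V) :
    (#|T| <= K)%N ->
  \sum_(s : {perm T}) \sum_(f : {ffun T -> I} | fixes s f) W (content f) =
  (\sum_(m : {ffun I -> 'I_K.+1} | (\sum_i m i == #|T|)%N)
     W [ffun i => val (m i)]) *+ #|T|`!.
Proof.
move=> hK.
rewrite -sumrMnl.
transitivity (\sum_(s : {perm T}) \sum_(m : {ffun I -> 'I_K.+1} | (\sum_i m i == #|T|)%N)
   W [ffun i => val (m i)] *+
     #|[set f : {ffun T -> I} | fixes s f & content f == [ffun i => val (m i)]]|).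
  apply: eq_bigr => s _.
  rewrite (partition_big (fun f : {ffun T -> I} => [ffun i => inord (content f i)] : {ffun I -> 'I_K.+1})
    (fun m : {ffun I -> 'I_K.+1} => (\sum_i m i == #|T|)%N)) /=; last first.
    move=> f _; apply/eqP; rewrite -(sum_content f); apply: eq_bigr => i _.
    rewrite ffunE inordK // ltnS (leq_trans _ hK) //.
    by rewrite -(sum_content f) (bigD1 i) //= leq_addr.
  apply: eq_bigr => m hm; rewrite -sumr_const; apply: eq_big => [f|f].
    rewrite inE; congr (_ && _); apply/eqP/eqP => [<-|h].
      apply/ffunP => i; rewrite !ffunE inordK ?ltnS ?(leq_trans _ hK) // .
      exact: max_card.
    by apply/ffunP => i; rewrite h !ffunE inord_val.
  case/andP=> _ /eqP <-; congr W; apply/ffunP => i; rewrite !ffunE inordK // ltnS.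
  by rewrite (leq_trans _ hK) // max_card.
rewrite exchange_big /=; apply: eq_bigr => m /eqP hm.
rewrite sumrMnr sum_fixes_content // -hm.
by apply: eq_bigr => i _; rewrite ffunE.
Qed.

(** * Complete symmetric functions and the Jacobi-Trudi identity *)
Section Complete.
Variables (A : comNzRingType) (N : nat) (z : 'I_N -> A) (K : nat).

(** The generating series of the complete symmetric functions of the [z i],
truncated at degree [K] in each variable; its coefficients are the right ones up to
degree [K]. *)
Definition hseries := \prod_(i < N) \sum_(k < K.+1) (z i ^+ k) *: 'X^k.

Definition hsym (d : nat) : A := hseries`_d.

Lemma hsymE d :
  hsym d = \sum_(r : {ffun 'I_N -> 'I_K.+1} | (\sum_i r i == d)%N)
             \prod_i z i ^+ r i.
Proof.
rewrite /hsym /hseries bigA_distr_bigA coef_sum [RHS]big_mkcond /=.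
apply: eq_bigr => r _.
have -> : \prod_i (z i ^+ r i *: 'X^(r i)) = (\prod_i z i ^+ r i) *: 'X^(\sum_i r i)%N :> {poly A}.
  by rewrite scaler_prod; congr (_ *: _); rewrite prodrXr.
by rewrite coefZ coefXn eq_sym; case: eqP => _; rewrite ?mulr1 ?mulr0.
Qed.

End Complete.

Section Cauchy.
Variables (T : finType) (A : comNzRingType) (N M : nat) (z : 'I_N -> A) (K : nat).

Lemma prod_content (f : {ffun T -> 'I_N}) : \prod_x z (f x) = \prod_i z i ^+ content f i.
Proof.
rewrite (partition_big f predT) //=; apply: eq_bigr => i _.
rewrite ffunE -prodr_const; apply: eq_big => [x|x /eqP -> //].
by rewrite inE.
Qed.

(** A pair of colourings of [T] is one colouring by pairs of colours, whose
content is a matrix.  Its row sums are the content of the first colouring, and its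
column sums, prescribed by [b], that of the second; summing over the columns
independently gives a product of complete symmetric functions. *)
Lemma sum_fixes_pair (b : {ffun 'I_M -> nat}) :
    (#|T| <= K)%N -> (\sum_j b j = #|T|)%N ->
  \sum_(s : {perm T}) (\sum_(f : {ffun T -> 'I_N} | fixes s f) \prod_x z (f x)) *+
     #|[set g : {ffun T -> 'I_M} | fixes s g & content g == b]|
  = (\prod_j hsym z K (b j)) *+ #|T|`!.
Proof.
move=> hK hb.
pose W (m : {ffun 'I_N * 'I_M -> nat}) : A :=
  if [forall j, (\sum_i m (i, j) == b j)%N] then \prod_j \prod_i z i ^+ m (i, j) else 0.
transitivity (\sum_(s : {perm T}) \sum_(F : {ffun T -> 'I_N * 'I_M} | fixes s F) W (content F)).
  apply: eq_bigr => s _; rewrite -sumr_const exchange_big /= pair_big /=.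
  pose h (u : {ffun T -> 'I_N} * {ffun T -> 'I_M}) : {ffun T -> 'I_N * 'I_M} :=
    [ffun x => (u.1 x, u.2 x)].
  pose h' (F : {ffun T -> 'I_N * 'I_M}) : {ffun T -> 'I_N} * {ffun T -> 'I_M} :=
    ([ffun x => (F x).1], [ffun x => (F x).2]).
  rewrite (reindex h') /=; last first.
    exists h => [F _|[f g] _].
      by apply/ffunP=> x; rewrite !ffunE /=; case: (F x).
    by congr pair; apply/ffunP=> x; rewrite !ffunE.
  have hfix F : fixes s (h' F).1 && fixes s (h' F).2 = fixes s F.
    apply/andP/forallP => [[/forallP h1 /forallP h2] x|h1].
      have := h1 x; have := h2 x; rewrite !ffunE => /eqP e1 /eqP e2.
      by rewrite [F (s x)]surjective_pairing [F x]surjective_pairing e1 e2.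
    by split; apply/forallP=> x; rewrite !ffunE (eqP (h1 x)).
  have hc F i : content (h' F).1 i = (\sum_j content F (i, j))%N.
    rewrite ffunE -sum1_card (partition_big (h' F).2 predT) //=.
    apply: eq_bigr => j _; rewrite ffunE -sum1_card; apply: eq_bigl => x.
    by rewrite !inE !ffunE -xpair_eqE -surjective_pairing.
  have hc' F j : content (h' F).2 j = (\sum_i content F (i, j))%N.
    rewrite ffunE -sum1_card (partition_big (h' F).1 predT) //=.
    apply: eq_bigr => i _; rewrite ffunE -sum1_card; apply: eq_bigl => x.
    by rewrite !inE !ffunE andbC -xpair_eqE -surjective_pairing.
  rewrite [RHS](eq_bigl (fun F => fixes s (h' F).1 && fixes s (h' F).2)) //.
  rewrite big_mkcond [RHS]big_mkcond /=; apply: eq_bigr => F _.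
  rewrite inE andbC; case: (fixes s [ffun x => (F x).1]); rewrite /= ?andbF //.
  case: (fixes s [ffun x => (F x).2]); rewrite /= ?andbT //.
  rewrite /W.
  have -> : [forall j, (\sum_i content F (i, j) == b j)%N] = (content (h' F).2 == b).
    apply/forallP/eqP => [h1|<- j]; last by rewrite hc'.
    by apply/ffunP=> j; rewrite hc' (eqP (h1 j)).
  rewrite /=; case: eqP => // _.
  rewrite -/((h' F).1) prod_content exchange_big /=; apply: eq_bigr => i _.
  by rewrite hc prodrXr.
rewrite (sum_fixes _ hK); congr (_ *+ _).
transitivity (\sum_(m : {ffun 'I_N * 'I_M -> 'I_K.+1}) W [ffun i => val (m i)]).
  rewrite big_mkcond; apply: eq_bigr => m _; case: eqP => // hm.
  rewrite /W; case: forallP => // hf; case: hm.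
  rewrite -hb (eq_bigr (fun u => val (m (u.1, u.2)))) => [|[i j] _ //].
  rewrite -(pair_bigA _ (fun i j => val (m (i, j)))) exchange_big /=.
  apply: eq_bigr => j _; rewrite -(eqP (hf j)).
  by apply: eq_bigr => i _; rewrite ffunE.
under [RHS]eq_bigr => j _ do rewrite hsymE big_mkcond /=.
rewrite bigA_distr_bigA /=.
pose c (u : {ffun 'I_M -> {ffun 'I_N -> 'I_K.+1}}) : {ffun 'I_N * 'I_M -> 'I_K.+1} :=
  [ffun v => u v.2 v.1].
rewrite (reindex c) /=; last first.
  exists (fun m => [ffun j => [ffun i => m (i, j)]]) => [u _|m _].
    by apply/ffunP=> j; rewrite ffunE; apply/ffunP=> i; rewrite !ffunE.
  by apply/ffunP=> -[i j]; rewrite !ffunE.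
apply: eq_bigr => u _; rewrite /W.
have hh j : (\sum_i [ffun i0 => \val (c u i0)] (i, j) = \sum_i u j i)%N.
  by apply: eq_bigr => i _; rewrite !ffunE.
case: forallP => h1.
  apply: eq_bigr => j _; rewrite -hh (h1 j).
  by apply: eq_bigr => i _; rewrite !ffunE.
have /forallPn[j hj] : ~~ [forall j, (\sum_i u j i == b j)%N].
  by apply/negP => /forallP h2; apply: h1 => j; rewrite hh.
by rewrite (bigD1 j) //= (negbTE hj) mul0r.
Qed.

End Cauchy.

Section JacobiTrudi.
Variables (A : comNzRingType) (N : nat) (z : 'I_N -> A) (K : nat).

(** The complete symmetric function of degree [d - j], which is 0 when the degree
is negative. *)
Definition hshift (d j : nat) : A := if (j <= d)%N then hsym z K (d - j) else 0.

Definition alternant (b : 'I_N -> nat) : A := \det (\matrix_(i, k) z k ^+ b i).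

Let G k : {poly A} := \sum_(i < K.+1) (z k ^+ i) *: 'X^i.
Let E k : {poly A} := \prod_(l < N | l != k) (1 - z l *: 'X).

Lemma geometric_inverse k :
  (\sum_(i < K.+1) (z k ^+ i) *: 'X^i) * (1 - z k *: 'X) =
  1 + 'X^(K.+1) * (- z k ^+ K.+1)%:P.
Proof.
rewrite (eq_bigr (fun i : 'I_K.+1 => (z k *: 'X) ^+ i)) => [|i _]; last by rewrite exprZn.
rewrite mulrC -[1 - _]opprB mulNr -subrX1 opprB exprZn polyCN mulrN -mul_polyC.
by rewrite [_%:P * _]mulrC.
Qed.

(** Multiplying by the factors [1 - z l *: 'X] with [l != k] leaves only the
geometric series of [z k], up to terms of degree above [K]. *)
Lemma hseries_quotient k : exists q, hseries z K * E k = G k * (1 + 'X^(K.+1) * q).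
Proof.
rewrite /hseries (bigD1 k) //= /E -mulrA -big_split /=.
suff [q ->] : exists q, \prod_(i < N | i != k)
    ((\sum_(k0 < K.+1) z i ^+ k0 *: 'X^k0) * (1 - z i *: 'X)) = 1 + 'X^(K.+1) * q.
  by exists q.
apply: (big_ind (fun p => exists q, p = 1 + 'X^(K.+1) * q)).
- by exists 0; rewrite mulr0 addr0.
- move=> _ _ [q1 ->] [q2 ->]; exists (q1 + q2 + 'X^(K.+1) * q1 * q2); ring.
- move=> i _; rewrite geometric_inverse; by eexists.
Qed.

(** Comparison of coefficients in [hseries_quotient].  The second factor does not
depend on [d], so this is a matrix factorisation of [z k ^+ b i], which is all that
the Jacobi-Trudi identity needs. *)
Lemma power_hsym k d : (d <= K)%N ->
  z k ^+ d = \sum_(j < N) hshift d j * (E k)`_j.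
Proof.
move=> hd.
have <- : (hseries z K * E k)`_d = z k ^+ d.
  have [q ->] := hseries_quotient k.
  rewrite mulrDr mulr1 coefD mulrCA coefXnM ltnS hd addr0.
  rewrite coef_sum (bigD1 (inord d)) //= coefZ coefXn inordK // eqxx mulr1.
  rewrite big1 ?addr0 // => i hi; rewrite coefZ coefXn.
  case: eqP => [e|]; last by rewrite mulr0.
  by case/eqP: hi; apply: val_inj; rewrite /= inordK.
rewrite coefMr.
rewrite (big_ord_widen_cond (d + N).+1 xpredT (fun j => (hseries z K)`_(d - j) * (E k)`_j)) /=; last by lia.
rewrite (big_ord_widen_cond (d + N).+1 xpredT (fun j => hshift d j * (E k)`_j)) /=; last by lia.
rewrite big_mkcond [RHS]big_mkcond; apply: eq_bigr => j _; rewrite /hshift ltnS.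
case: (leqP j d) => hj; last by rewrite mul0r if_same.
case: ltnP => hN //; rewrite [_`_j]nth_default ?mulr0 //.
apply: leq_trans hN.
have hsz (r : seq 'I_N) : (size (\prod_(l <- r | l != k) (1 - z l *: 'X) : {poly A})%R
    <= (size [seq l <- r | l != k]).+1)%N.
  elim: r => [|l r IH]; first by rewrite big_nil size_poly1.
  rewrite big_cons /=; case: ifP => //= _.
  apply: leq_trans (size_polyMleq _ _) _.
  have : (size (1 - z l *: 'X)%R <= 2)%N.
    apply: leq_trans (size_polyD _ _) _; rewrite geq_max size_poly1 size_polyN.
    by apply: leq_trans (size_scale_leq _ _) _; rewrite size_polyX.
  move=> h2; rewrite -subn1 leq_subLR; apply: leq_trans (leq_add h2 IH) _.
  by rewrite add2n add1n.
apply: leq_trans (hsz _) _.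
rewrite size_filter -sum1_count -[X in (_ < X)%N](card_ord N) -sum1_card.
rewrite [X in (_ < X)%N](bigD1 k) //= add1n ltnS.
Qed.

(** Take determinants in the factorisation [power_hsym]; the determinant of the
factor that does not involve [b] is found from the case [b = id], where the other
factor is unitriangular. *)
Lemma jacobi_trudi (b : 'I_N -> nat) : (forall i, b i <= K)%N -> (N <= K)%N ->
  \det (\matrix_(i, j) hshift (b i) j) * alternant (fun i => i) = alternant b.
Proof.
move=> hb hN.
pose EM := \matrix_(j < N, k < N) (E k)`_j.
have key (c : 'I_N -> nat) : (forall i, c i <= K)%N ->
    (\matrix_(i, j) hshift (c i) j) *m EM = \matrix_(i, k) z k ^+ c i.
  move=> hc; apply/matrixP=> i k; rewrite !mxE power_hsym //.
  by apply: eq_bigr => j _; rewrite !mxE.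
have hE : \det EM = alternant (fun i => i).
  rewrite /alternant -key => [|i]; last by rewrite (leq_trans (ltnW (ltn_ord i))).
  rewrite det_mulmx det_trig; last first.
    by apply/is_trig_mxP => i j hij; rewrite mxE /hshift leqNgt hij.
  rewrite big1 ?mul1r // => i _; rewrite mxE /hshift leqnn subnn.
  rewrite hsymE (bigD1 [ffun=> ord0]) /=; last by rewrite big1 // => j _; rewrite ffunE.
  rewrite big1 => [|j _]; last by rewrite ffunE expr0.
  rewrite big1 ?addr0 // => r /andP[/eqP h1 /eqP h2]; case: h2.
  apply/ffunP=> j; rewrite ffunE; apply: val_inj => /=.
  by apply/eqP; move/eqP: h1; rewrite sum_nat_eq0 => /forallP/(_ j).
by rewrite -hE -det_mulmx key.
Qed.

End JacobiTrudi.

(** * Characters from alternating polynomials *)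
Lemma permutation_character (gT : finGroupType) (rT : finType)
    (to : {action gT &-> rT}) (S : {set rT}) :
    [acts [set: gT], on S | to] ->
  exists2 chi : 'CF([set: gT]), chi \is a character &
    forall g, chi g = #|[set x in S | to x g == x]|%:R.
Proof.
move=> actS.
have memS x g : x \in S -> to x g \in S.
  by move=> hx; rewrite (actsP actS) ?inE.
pose r (g : gT) : 'M[algC]_#|S| :=
  \matrix_(i, j) (to (enum_val i) g == enum_val j)%:R.
have rP : mx_repr [set: gT] r.
  split=> [|g h _ _]; apply/matrixP=> i k; rewrite !mxE.
    by rewrite act1 (inj_eq enum_val_inj).
  have hi := memS _ g (enum_valP i).
  rewrite (bigD1 (enum_rank_in hi (to (enum_val i) g))) //= big1 => [|j hj].
    by rewrite !mxE !enum_rankK_in // eqxx mul1r addr0 actM.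
  rewrite !mxE; case: eqP => [e|]; last by rewrite mul0r.
  by case/eqP: hj; apply: enum_val_inj; rewrite enum_rankK_in.
exists (cfRepr (MxRepresentation rP)); first exact: cfRepr_char.
move=> g; rewrite cfunE inE mulr1n /mxtrace.
transitivity (\sum_(i < #|S|) (to (enum_val i) g == enum_val i)%:R : algC).
  by apply: eq_bigr => i _; rewrite mxE.
rewrite -(big_enum_val (fun x => (to x g == x)%:R : algC)) -natr_sum -sum1_card.
congr _%:R.
rewrite [RHS](eq_bigl (fun x => (x \in S) && (to x g == x))) => [|x]; last by rewrite inE.
by rewrite big_mkcondr; apply: eq_bigr => x _; case: eqP.
Qed.

Lemma colouring_character (T I : finType) (P : pred {ffun I -> nat}) :
  exists2 chi : 'CF([set: {perm T}]), chi \is a character &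
    forall s, chi s = #|[set f : {ffun T -> I} | fixes s f & P (content f)]|%:R.
Proof.
have actS : [acts [set: {perm T}], on [set f : {ffun T -> I} | P (content f)] | @recolour_action T I].
  by apply/actsP=> s _ f; rewrite !inE /= content_recolour.
have [chi hchi hval] := permutation_character actS.
exists chi => // s; rewrite hval; congr _%:R; apply: eq_card => f.
by rewrite !inE /= recolour_fixes andbC.
Qed.

Section AlternantCharacters.
Variables (T : finType) (N : nat).
Local Notation G := [set: {perm T}].
Implicit Types (a b : 'I_N -> nat) (s : {perm T}).

(** Coefficient extraction in the Vandermonde polynomial, for exponents that are
allowed to be negative: the sign of [a] if it is a permutation of [0, ..., N - 1],
and 0 otherwise. *)
Definition vacuum (a : {ffun 'I_N -> int}) : int :=
  \det (\matrix_(i, j) (a i == j%:Z)%:R).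

(** The coefficient of the monomial with exponents [a] in the product of the power
sums attached to the cycles of [s] with the Vandermonde polynomial (see
[coef_power_delta]). *)
Definition alt_char a s : int :=
  \sum_(f : {ffun T -> 'I_N} | fixes s f) vacuum [ffun i => (a i)%:Z - (content f i)%:Z].

Lemma vacuum_sub a (c : {ffun 'I_N -> nat}) :
  vacuum [ffun i => (a i)%:Z - (c i)%:Z] =
  \sum_(w : 'S_N) (-1) ^+ w * [forall i, (a i == c i + w i)%N]%:R.
Proof.
apply: eq_bigr => w _; congr (_ * _).
under eq_bigr => i _ do rewrite mxE ffunE subr_eq -PoszD eqz_nat addnC.
case: forallP => h; first by rewrite big1 // => i _; rewrite h.
have /forallPn[i hi] : ~~ [forall i, (a i == c i + w i)%N] by apply/forallP.
by rewrite (bigD1 i) //= (negbTE hi) mul0r.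
Qed.

Lemma alt_char_sum a s : alt_char a s =
  \sum_(w : 'S_N) (-1) ^+ w *
    #|[set f : {ffun T -> 'I_N} | fixes s f & [forall i, (a i == content f i + w i)%N]]|%:R.
Proof.
rewrite /alt_char; under eq_bigr => f _ do rewrite vacuum_sub.
rewrite exchange_big /=; apply: eq_bigr => w _; rewrite -mulr_sumr; congr (_ * _).
rewrite -natr_sum -sum1_card; congr _%:R.
rewrite [RHS](eq_bigl (fun f => fixes s f && [forall i, (a i == content f i + w i)%N])) => [|f]; last by rewrite inE.
by rewrite big_mkcondr; apply: eq_bigr => f _; case: ifP.
Qed.

(** By [alt_char_sum] the function is a signed sum of permutation characters on
sets of colourings with prescribed content. *)
Lemma alt_cfun_exists a :
  exists2 chi : 'CF(G), (chi \in 'Z[irr G])%g & forall s, chi s = (alt_char a s)%:~R.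
Proof.
have /fin_all_exists2[chi hchi hval] := fun w : 'S_N =>
  @colouring_character T 'I_N (fun c => [forall i, (a i == c i + w i)%N]).
exists (\sum_(w : 'S_N) (-1) ^+ w *: chi w).
  by apply: rpred_sum => w _; rewrite rpredZsign; apply: char_vchar.
move=> s; rewrite alt_char_sum sum_cfunE rmorph_sum /=; apply: eq_bigr => w _.
by rewrite cfunE hval rmorphM rmorphXn rmorphN1 /= mulrz_nat.
Qed.

End AlternantCharacters.

(** The polynomial form of [alt_char]: it gives orthogonality through the
Jacobi-Trudi identity, and later completeness because polynomials form a
domain. *)
Section Orthogonality.
Variables (T : finType) (N : nat).
Implicit Types (a b : 'I_N -> nat) (s : {perm T}).

Definition power_poly (R : comNzRingType) s : {mpoly R[N]} :=
  \sum_(f : {ffun T -> 'I_N} | fixes s f) \prod_x 'X_(f x).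

Definition delta_poly (R : comNzRingType) : {mpoly R[N]} :=
  alternant (fun i => 'X_i) (fun i => i).

Lemma prod_mpolyX (R : comNzRingType) (c : 'I_N -> nat) :
  \prod_i 'X_i ^+ c i = 'X_[[multinom c i | i < N]] :> {mpoly R[N]}.
Proof. by rewrite mpolyXE_id; apply: eq_bigr => i _; rewrite mnmE. Qed.

Lemma coef_power_delta (R : comNzRingType) a s :
  (power_poly R s * delta_poly R)@_[multinom a i | i < N] = (alt_char a s)%:~R.
Proof.
rewrite /power_poly mulr_suml raddf_sum /alt_char rmorph_sum /=.
apply: eq_bigr => f _; rewrite (prod_content (fun i => 'X_i)) prod_mpolyX vacuum_sub.
rewrite /delta_poly /alternant -det_tr /determinant mulr_sumr raddf_sum rmorph_sum /=.
apply: eq_bigr => w _.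
under eq_bigr => i _ do rewrite !mxE.
rewrite prod_mpolyX rmorphM rmorphXn rmorphN1 /= mulrz_nat mulrCA -mpolyXD.
rewrite !mulr_sign.
have e : ([multinom content f i | i < N] + [multinom (w i : nat) | i < N] ==
    [multinom a i | i < N])%MM = [forall i, (a i == content f i + w i)%N].
  apply/eqP/forallP => [/mnmP h i|h].
    by have := h i; rewrite mnmDE !mnmE => ->.
  by apply/mnmP => i; rewrite mnmDE !mnmE (eqP (h i)).
by case: (odd_perm w); rewrite ?mcoeffN mcoeffX e.
Qed.

Lemma coef_alternant (R : comNzRingType) a b :
  (alternant (fun i => 'X_i) b : {mpoly R[N]})@_[multinom a i | i < N] =
  \sum_(w : 'S_N) (-1) ^+ w * [forall i, a (w i) == b i]%:R.
Proof.
rewrite /alternant /determinant raddf_sum /=; apply: eq_bigr => w _.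
under eq_bigr => i _ do rewrite !mxE.
rewrite (reindex_inj (@perm_inj _ (w^-1)%g)) /=.
under eq_bigr => i _ do rewrite permKV.
rewrite prod_mpolyX !mulr_sign.
have -> : [forall i, a (w i) == b i] = ([multinom b ((w^-1)%g i) | i < N] == [multinom a i | i < N]).
  apply/forallP/eqP => [h|/mnmP h i].
    by apply/mnmP => i; rewrite !mnmE -(eqP (h _)) permKV.
  by have := h (w i); rewrite !mnmE permK => ->.
by case: (odd_perm w); rewrite ?mcoeffN mcoeffX.
Qed.

(** [sum_fixes_pair] for the exponents [b i - w i], the terms of a Jacobi-Trudi
determinant. *)
Lemma hshift_prod (A : comNzRingType) (z : 'I_N -> A) K b (w : 'S_N) :
    (#|T| <= K)%N -> (\sum_i b i = #|T| + \sum_(i < N) i)%N ->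
  \sum_(s : {perm T}) (\sum_(f : {ffun T -> 'I_N} | fixes s f) \prod_x z (f x)) *+
     #|[set f : {ffun T -> 'I_N} | fixes s f & [forall i, (b i == content f i + w i)%N]]|
  = (\prod_i hshift z K (b i) (w i)) *+ #|T|`!.
Proof.
move=> hK hb; case: (boolP [forall i, (w i <= b i)%N]) => [/forallP hw | /forallPn[i hi]].
  pose c : {ffun 'I_N -> nat} := [ffun i => (b i - w i)%N].
  have hc : (\sum_j c j = #|T|)%N.
    apply/eqP; rewrite -(eqn_add2r (\sum_(i < N) i)) -hb.
    rewrite [X in (_ + X)%N](reindex_inj (@perm_inj _ w)) /= -big_split /=; apply/eqP.
    by apply: eq_bigr => i _; rewrite ffunE subnK.
  rewrite (eq_bigr (fun j => hsym z K (c j))); last by move=> i _; rewrite /hshift hw ffunE.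
  rewrite -(sum_fixes_pair z hK hc); apply: eq_bigr => s _; congr (_ *+ _).
  apply: eq_card => f; rewrite !inE; congr (_ && _).
  apply/forallP/eqP => [h|h i].
    by apply/ffunP => i; rewrite [RHS]ffunE (eqP (h i)) addnK.
  by have /ffunP/(_ i) := h; rewrite [RHS]ffunE => ->; rewrite subnK.
rewrite (bigD1 i) //= /hshift (negbTE hi) mul0r mul0rn big1 // => s _.
rewrite (_ : [set f | _ & _] = set0) ?cards0 //; apply/setP => f; rewrite !inE.
apply/negbTE/negP => /andP[_ /forallP/(_ i)/eqP h].
by move: hi; rewrite h leq_addl.
Qed.

(** Summing [alt_char b s] against the power sum products gives a determinant of
complete symmetric functions; multiplied by the Vandermonde polynomial it becomes
the alternating polynomial with exponents [b], whose coefficients are signs. *)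
Lemma alt_char_orthogonality a b :
    (\sum_i b i = #|T| + \sum_(i < N) i)%N ->
  \sum_(s : {perm T}) alt_char a s * alt_char b s =
  (\sum_(w : 'S_N) (-1) ^+ w * [forall i, a (w i) == b i]%:R) *+ #|T|`!.
Proof.
move=> hb; pose K := (#|T| + N + \sum_i b i)%N.
rewrite -coef_alternant -(@jacobi_trudi _ _ _ K); last 2 first.
- by move=> i; rewrite /K (bigD1 i) //=; lia.
- by rewrite /K; lia.
rewrite -mcoeffMn.
have -> : \det (\matrix_(i, j) hshift (fun i0 => 'X_i0 : {mpoly int[N]}) K (b i) j) *
    alternant (fun i => 'X_i) (fun i => i) *+ #|T|`! =
    \sum_(s : {perm T}) power_poly int s * delta_poly int * (alt_char b s)%:MP.
  rewrite -mulrnAl -/(delta_poly int) -[RHS](eq_bigr _ (fun s _ => mulrAC _ _ _)).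
  rewrite -mulr_suml; congr (_ * _).
  transitivity (\sum_(w : 'S_N) \sum_(s : {perm T}) power_poly int s *
     ((-1) ^+ w * #|[set f : {ffun T -> 'I_N} | fixes s f & [forall i, (b i == content f i + w i)%N]]|%:R : int)%:MP).
    rewrite /determinant -sumrMnl; apply: eq_bigr => w _.
    rewrite (eq_bigr (fun i => hshift (fun i0 : 'I_N => 'X_i0) K (b i) (w i))) => [|i _]; last by rewrite mxE.
    rewrite -mulrnAr -hshift_prod // ?mulr_sumr; last by rewrite /K; lia.
    apply: eq_bigr => s _; rewrite rmorphM rmorphXn rmorphN1 /= rmorph_nat mulrCA.
    by rewrite mulr_natr.
  rewrite exchange_big /=; apply: eq_bigr => s _; rewrite -mulr_sumr; congr (_ * _).
  by rewrite alt_char_sum rmorph_sum.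
rewrite raddf_sum /=; apply: eq_bigr => s _.
by rewrite [X in mcoeff _ X]mulrC mcoeffCM mulrC coef_power_delta intz.
Qed.
End Orthogonality.

(** * The values that determine the eigenvalue of convolution *)
Lemma mderiv_linear_power (N n : nat) (i : 'I_N) :
  mderiv i ((\sum_k 'X_k : {mpoly int[N]}) ^+ n.+1) = (\sum_k 'X_k) ^+ n *+ n.+1.
Proof.
have h1 : mderiv i (\sum_k 'X_k : {mpoly int[N]}) = 1.
  rewrite raddf_sum (bigD1 i) //= mderivX mnm1E eqxx scale1r.
  rewrite big1 => [|k hk]; last by rewrite mderivX mnm1E (negbTE hk) scale0r.
  by rewrite addr0 -mpolyX0; congr 'X_[_]; apply/mnmP => j; rewrite mnmBE mnm0E subnn.
elim: n => [|n IH]; first by rewrite expr1 expr0 h1.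
by rewrite exprS mderivM h1 mul1r IH mulrnAr -exprS -mulrS.
Qed.

(** Induction by differentiating with respect to a variable that occurs in the
monomial. *)
Lemma multinomial_coef (N n : nat) (m : 'X_{1.. N}) : mdeg m = n ->
  ((\sum_i 'X_i : {mpoly int[N]}) ^+ n)@_m * (\prod_i (m i)`!)%:R = n`!%:R.
Proof.
elim: n m => [|n IH] m hm.
  have -> : m = 0%MM by apply/eqP; rewrite -mdeg_eq0 hm.
  by rewrite expr0 mcoeff1 eqxx mul1r big1 // => i _; rewrite mnm0E.
have [i hi] : exists i, (0 < m i)%N.
  apply/existsP; rewrite -[X in is_true X]negbK negb_exists; apply/negP => /forallP h.
  suff : mdeg m = 0%N by rewrite hm.
  by rewrite mdegE big1 // => i _; apply/eqP; have := h i; rewrite lt0n negbK.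
pose m' := (m - U_(i))%MM.
have em : m = (m' + U_(i))%MM.
  by rewrite submK //; apply/mnm_lepP => j; rewrite mnm1E; case: eqP => [<-|].
have hm' : mdeg m' = n.
  by move: hm; rewrite em mdegD mdeg1 addn1 => -[].
have emi : m i = (m' i).+1 by rewrite [in LHS]em mnmDE mnm1E eqxx addn1.
have := mcoeff_mderiv i ((\sum_i 'X_i : {mpoly int[N]}) ^+ n.+1) m'.
rewrite mderiv_linear_power -em mcoeffMn => h.
have -> : (\prod_j (m j)`! = (m i) * \prod_j (m' j)`!)%N.
  rewrite (bigD1 i) //= [in RHS](bigD1 i) //= mulnA emi factS; congr (_ * _)%N.
  by apply: eq_bigr => j hj; rewrite em mnmDE mnm1E eq_sym (negbTE hj) addn0.
rewrite natrM mulrA [X in X * _]mulr_natr emi -h -[X in X * _]mulr_natr mulrAC IH // -natrM.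
by rewrite factS mulnC.
Qed.

Lemma coef_geometric_power (M K d : nat) : (d <= K)%N ->
  (((\sum_(k < K.+1) 'X^k) ^+ M.+1 : {poly int})`_d = 'C(d + M, M)%:R).
Proof.
have hg j : (j <= K)%N -> (\sum_(k < K.+1) 'X^k : {poly int})`_j = 1.
  move=> hj; rewrite coef_sum (bigD1 (inord j)) //= coefXn inordK // eqxx.
  rewrite big1 ?addr0 // => k hk; rewrite coefXn.
  by case: eqP => // e; case/eqP: hk; apply: val_inj; rewrite /= inordK.
elim: M d => [|M IH] d hd; first by rewrite expr1 hg // addn0 bin0.
rewrite exprS coefM.
rewrite (eq_bigr (fun j : 'I_d.+1 => 'C(d - j + M, M)%:R)) => [|j _]; last first.
  have hj : (j <= d)%N by rewrite -ltnS.
  by rewrite hg ?(leq_trans hj hd) // mul1r IH // (leq_trans (leq_subr _ _) hd).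
rewrite -natr_sum; congr _%:R.
rewrite (reindex_inj rev_ord_inj) /=.
rewrite (eq_bigr (fun j : 'I_d.+1 => 'C(j + M, M))) => [|j _]; last first.
  by rewrite subSS subKn // -ltnS.
elim: d {hd} => [|d IHd]; first by rewrite big_ord_recl big_ord0 !add0n !binn.
by rewrite big_ord_recr /= IHd [in RHS]addSn binS addSnnS.
Qed.

Lemma hshift1 (M K d j : nat) : (d <= K)%N -> (j <= M)%N ->
  hshift (fun _ : 'I_M.+1 => 1 : int) K d j = 'C(d + (M - j), M)%:R.
Proof.
move=> hd hj; rewrite /hshift; case: leqP => h; last by rewrite bin_small //; lia.
rewrite /hsym /hseries (eq_bigr (fun=> \sum_(k < K.+1) 'X^k)) => [|i _]; last first.
  by apply: eq_bigr => k _; rewrite expr1n scale1r.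
rewrite prodr_const card_ord coef_geometric_power; last by lia.
by congr ('C(_, _)%:R); lia.
Qed.

(** By the Vandermonde convolution the two matrices differ by a unitriangular
factor. *)
Lemma det_shifted_binomials (M : nat) (a : 'I_M.+1 -> nat) :
  \det (\matrix_(i, j < M.+1) ('C(a i + (M - j), M)%:R : int)) =
  \det (\matrix_(i, j < M.+1) ('C(a i, j)%:R : int)).
Proof.
pose U : 'M[int]_M.+1 := \matrix_(k, j) 'C(M - j, M - k)%:R.
have hU : \det U = 1.
  rewrite det_trig; last first.
    apply/is_trig_mxP => i j hij; rewrite mxE bin_small //.
    by have := ltn_ord j; lia.
  by rewrite big1 // => i _; rewrite mxE binn.
rewrite -[RHS]mulr1 -[X in _ = _ * X]hU -det_mulmx; congr (\det _).
apply/matrixP=> i j; rewrite !mxE -(binomial.Vandermonde (a i) (M - j) M). rewrite natr_sum.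
by apply: eq_bigr => k _; rewrite !mxE natrM.
Qed.

Section ValueAtIdentity.
Variables (T : finType) (M : nat).
Local Notation N := M.+1.
Implicit Types (a : 'I_N -> nat).

Lemma card_content (c : {ffun 'I_N -> nat}) : (\sum_i c i = #|T|)%N ->
  (#|[set f : {ffun T -> 'I_N} | content f == c]| * \prod_i (c i)`! = #|T|`!)%N.
Proof.
move=> hc; pose m := [multinom c i | i < N].
have hm : mdeg m = #|T| by rewrite mdegE -hc; apply: eq_bigr => i _; rewrite mnmE.
apply/eqP; rewrite -(eqr_nat int) -(multinomial_coef hm) natrM; apply/eqP; congr (_ * _); last first.
  by congr _%:R; apply: eq_bigr => i _; rewrite mnmE.
have -> : (\sum_i 'X_i : {mpoly int[N]}) ^+ #|T| = \sum_(f : {ffun T -> 'I_N}) \prod_x 'X_(f x).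
  by rewrite -(bigA_distr_bigA (fun x i => 'X_i)) prodr_const.
rewrite raddf_sum /= -sum1_card natr_sum big_mkcond; apply: eq_bigr => f _.
rewrite (prod_content (fun i => 'X_i)) prod_mpolyX mcoeffX inE.
have -> : ([multinom content f i | i < N] == m) = (content f == c).
  apply/eqP/eqP => [/mnmP h|->] //; apply/ffunP => i.
  by have := h i; rewrite !mnmE.
by case: eqP.
Qed.

(** The number of colourings with content [a i - w i] is a multinomial
coefficient; after multiplication by [\prod_i (a i)`!] it becomes a product of
falling factorials, the general term of a determinant. *)
Lemma alt_char1 a : (\sum_i a i = #|T| + \sum_(i < N) i)%N ->
  (\prod_i (a i)`!)%:R * alt_char a (1%g : {perm T}) =
  #|T|`!%:R * (\prod_(i < N) i`!)%:R * \det (\matrix_(i, j < N) ('C(a i, j)%:R : int)).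
Proof.
move=> ha; rewrite alt_char_sum /determinant !mulr_sumr; apply: eq_bigr => w _.
rewrite mulrCA [RHS]mulrCA; congr (_ * _).
under [in RHS]eq_bigr => i _ do rewrite mxE.
rewrite -natr_prod -!natrM; congr _%:R.
case: (boolP [forall i, (w i <= a i)%N]) => [/forallP hw | /forallPn[i hi]].
  pose c : {ffun 'I_N -> nat} := [ffun i => (a i - w i)%N].
  have hc : (\sum_j c j = #|T|)%N.
    apply/eqP; rewrite -(eqn_add2r (\sum_(i < N) i)) -ha.
    rewrite [X in (_ + X)%N](reindex_inj (@perm_inj _ w)) /= -big_split /=; apply/eqP.
    by apply: eq_bigr => i _; rewrite ffunE subnK.
  rewrite -(card_content hc).
  rewrite (_ : [set f | _ & _] = [set f : {ffun T -> 'I_N} | content f == c]); last first.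
    apply/setP => f; rewrite !inE.
    rewrite (_ : fixes 1 f); last by apply/forallP => x; rewrite perm1.
    apply/forallP/eqP => [h|h i].
      by apply/ffunP => i; rewrite [RHS]ffunE (eqP (h i)) addnK.
    by have /ffunP/(_ i) := h; rewrite [RHS]ffunE => ->; rewrite subnK.
  rewrite mulnC -!mulnA; congr (_ * _)%N.
  rewrite [(\prod_(i < N) i`!)%N](reindex_inj (@perm_inj _ w)) /= -!big_split /=.
  by apply: eq_bigr => i _; rewrite ffunE -(bin_fact (hw i)); lia.
rewrite (_ : [set f | _ & _] = set0) ?cards0 ?muln0; last first.
  apply/setP => f; rewrite !inE; apply/negbTE/negP => /andP[_ /forallP/(_ i)/eqP h].
  by move: hi; rewrite h leq_addl.
by rewrite [X in (_ * X)%N](bigD1 i) //= bin_small ?muln0 // ltnNge.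
Qed.

(** [hshift_prod] with all variables equal to 1, where complete symmetric
functions are binomial coefficients. *)
Lemma alt_char_count a : (\sum_i a i = #|T| + \sum_(i < N) i)%N ->
  \sum_(s : {perm T}) #|[set f : {ffun T -> 'I_N} | fixes s f]|%:R * alt_char a s =
  #|T|`!%:R * \det (\matrix_(i, j < N) ('C(a i, j)%:R : int)).
Proof.
move=> ha; rewrite -det_shifted_binomials.
pose K := (#|T| + \sum_i a i)%N.
under eq_bigr => s _ do rewrite alt_char_sum mulr_sumr.
rewrite exchange_big /= /determinant mulr_sumr; apply: eq_bigr => w _.
under [in RHS]eq_bigr => i _ do rewrite mxE.
rewrite [RHS]mulrCA [_%:R * _]mulr_natl.
have hK i : (a i <= K)%N by rewrite /K (bigD1 i) //=; lia.
rewrite -(eq_bigr _ (fun i _ => hshift1 (hK i) (leq_ord (w i)))).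
rewrite -hshift_prod //; last by rewrite /K leq_addr.
rewrite mulr_sumr; apply: eq_bigr => s _.
rewrite mulrCA; congr (_ * _); rewrite -[RHS]mulr_natr; congr (_ * _).
rewrite (eq_bigr (fun _ : {ffun T -> 'I_N} => 1)) => [|f _]; last by exact: big1.
by rewrite -sumr_const; apply: eq_bigl => f; rewrite inE.
Qed.

(** Once [alt_char a] is known to be an eigenvector of convolution with the number
of fixed colourings, this equation at the identity gives the eigenvalue. *)
Lemma alt_char_trace a : (\sum_i a i = #|T| + \sum_(i < N) i)%N ->
  (\prod_(i < N) i`!)%:R *
  \sum_(s : {perm T}) #|[set f : {ffun T -> 'I_N} | fixes s f]|%:R * alt_char a s =
  (\prod_i (a i)`!)%:R * alt_char a (1%g : {perm T}).
Proof. by move=> ha; rewrite alt_char1 // alt_char_count // mulrCA mulrA. Qed.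

End ValueAtIdentity.

(** * Irreducibility and completeness *)
Lemma vacuum_perm (N : nat) (b : {ffun 'I_N -> int}) (p : 'S_N) :
  vacuum [ffun k => b (p k)] = (-1) ^+ p * vacuum b.
Proof.
rewrite /vacuum.
have -> : \matrix_(i, j) ([ffun k => b (p k)] i == j%:Z :> int)%:R =
   row_perm p (\matrix_(i, j) (b i == j%:Z)%:R : 'M[int]_N).
  by apply/matrixP=> i j; rewrite !mxE ffunE.
by rewrite row_permE det_mulmx det_perm.
Qed.

Lemma content_comp_perm (T : finType) (N : nat) (f : {ffun T -> 'I_N}) (p : 'S_N) i :
  content [ffun x => p (f x)] (p i) = content f i.
Proof.
rewrite !ffunE; apply: eq_card => x; rewrite !inE ffunE.
by rewrite (inj_eq perm_inj).
Qed.

Lemma fixes_comp_perm (T : finType) (N : nat) (f : {ffun T -> 'I_N}) (p : 'S_N) s :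
  fixes s [ffun x => p (f x)] = fixes s f.
Proof. by apply: eq_forallb => x; rewrite !ffunE (inj_eq perm_inj). Qed.

Lemma comp_perm_bij (T : finType) (N : nat) (p : 'S_N) :
  bijective (fun f : {ffun T -> 'I_N} => [ffun x => p (f x)]).
Proof.
exists (fun f : {ffun T -> 'I_N} => [ffun x => (p^-1)%g (f x)]) => f; apply/ffunP => x.
  by rewrite !ffunE permK.
by rewrite !ffunE permKV.
Qed.

Section Irreducibility.
Variables (T : finType) (M : nat).
Local Notation N := M.+1.
Local Notation G := [set: {perm T}]%G.
Implicit Types (a b : 'I_N -> nat) (s : {perm T}).

(** The degree of [p_s Delta]: other exponents do not occur. *)
Definition level a := (\sum_i a i == #|T| + \sum_(i < N) i)%N.

Definition fixcount s : int := #|[set f : {ffun T -> 'I_N} | fixes s f]|%:R.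

Lemma alt_char_level a s : ~~ level a -> alt_char a s = 0.
Proof.
move=> ha; rewrite /alt_char big1 // => f _; rewrite vacuum_sub big1 // => w _.
case: forallP => h; last by rewrite mulr0.
case/negP: ha; rewrite /level (eq_bigr _ (fun i _ => eqP (h i))) big_split /=.
rewrite sum_content; apply/eqP; congr (_ + _)%N.
by rewrite [RHS](reindex_inj (@perm_inj _ w)).
Qed.

Lemma alt_char_perm a s (p : 'S_N) : alt_char (a \o p) s = (-1) ^+ p * alt_char a s.
Proof.
rewrite /alt_char mulr_sumr.
rewrite [RHS](reindex _ (onW_bij _ (comp_perm_bij T p))) /=.
apply: eq_big => [f|f _]; first by rewrite fixes_comp_perm.
rewrite -vacuum_perm; congr vacuum; apply/ffunP => i.
by rewrite [LHS]ffunE [RHS]ffunE [RHS]ffunE content_comp_perm.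
Qed.

(** Exchanging two equal entries changes the sign but not the function. *)
Lemma alt_char_noninj a s : ~~ injectiveb a -> alt_char a s = 0.
Proof.
case/injectivePn => i [j hij e].
have := alt_char_perm a s (tperm i j).
rewrite odd_tperm hij expr1 mulN1r.
rewrite (_ : alt_char (a \o _) s = alt_char a s); first lia.
apply: eq_bigr => f _; congr vacuum; apply/ffunP => k; rewrite !ffunE /=.
by case: tpermP => // ->; rewrite e.
Qed.

Lemma alt_char_norm a : injective a -> level a ->
  \sum_(s : {perm T}) alt_char a s * alt_char a s = #|T|`!%:R.
Proof.
move=> inja /eqP ha; rewrite alt_char_orthogonality // (bigD1 1%g) //=.
rewrite odd_perm1 expr0 mul1r big1 => [|w hw].
  by rewrite (_ : [forall i, _]) ?addr0 //; apply/forallP => i; rewrite perm1.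
case: forallP => h; last by rewrite mulr0.
by case/eqP: hw; apply/permP => i; rewrite perm1; apply/inja/eqP.
Qed.

Lemma cfdot_int (phi psi : 'CF(G)) (F H : {perm T} -> int) :
    (forall s, phi s = (F s)%:~R) -> (forall s, psi s = (H s)%:~R) ->
  '[phi, psi] = (#|T|`!%:R)^-1 * (\sum_(s : {perm T}) F s * H s)%:~R.
Proof.
move=> hF hH; rewrite cfdotE card_permT; congr (_ * _).
rewrite rmorph_sum /=; apply: eq_big => [s|s _]; first by rewrite inE.
by rewrite hF hH rmorphM /= conj_intr // intr_int.
Qed.

Lemma fact_neq0 : (#|T|`!%:R : algC) != 0.
Proof. by rewrite pnatr_eq0 -lt0n fact_gt0. Qed.

(** A virtual character of norm 1. *)
Lemma alt_char_irr a : injective a -> level a ->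
  exists b : bool, exists i : Iirr G,
    forall s : {perm T}, ((alt_char a s)%:~R : algC) = (-1) ^+ b * 'chi_i s.
Proof.
move=> inja ha; have [chi hv hchi] := alt_cfun_exists T a.
have [|b [i hi]] := vchar_norm1P hv.
  rewrite (cfdot_int hchi hchi) alt_char_norm // mulrz_nat mulVf //.
  exact: fact_neq0.
by exists b, i => s; rewrite -hchi hi cfunE.
Qed.

End Irreducibility.

(** A class function is a combination of irreducible characters, and by the
generalised orthogonality relation only the component along ['chi_j] survives. *)
Lemma irr_convolution (gT : finGroupType) (G : {group gT}) (theta : 'CF(G)) (j : Iirr G) :
  exists c, forall y, y \in G ->
    \sum_(x in G) theta (x * y)%g * 'chi_j (x^-1)%g = c * 'chi_j y.
Proof.
exists (#|G|%:R * '[theta, 'chi_j] / 'chi_j 1%g) => y Gy.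
rewrite {1}(cfun_sum_cfdot theta).
under eq_bigr => x _ do rewrite sum_cfunE mulr_suml.
rewrite exchange_big /= (bigD1 j) //= [X in _ + X]big1 => [|i hij].
  under eq_bigr => x _ do rewrite cfunE -mulrA.
  rewrite -mulr_sumr addr0.
  have := generalized_orthogonality_relation y j j; rewrite eqxx mul1r => h.
  rewrite -[X in _ * X = _](mulVKf (neq0CG G)) h; field; exact: irr1_neq0.
under eq_bigr => x _ do rewrite cfunE -mulrA.
rewrite -mulr_sumr.
have := generalized_orthogonality_relation y i j; rewrite (negbTE hij) mul0r.
move/eqP; rewrite mulf_eq0 invr_eq0 (negbTE (neq0CG G)) /= => /eqP ->.
by rewrite mulr0.
Qed.

Lemma fixesV (T I : finType) (s : {perm T}) (f : {ffun T -> I}) :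
  fixes s^-1 f = fixes s f.
Proof.
apply/forallP/forallP => h x.
  by have := h (s x); rewrite permK eq_sym.
by have := h ((s^-1)%g x); rewrite permKV eq_sym.
Qed.

Section ClassSums.
Variables (T : finType) (M : nat).
Local Notation N := M.+1.
Local Notation G := [set: {perm T}]%G.
Hypothesis leTN : (#|T| <= N)%N.
Implicit Types (a b : 'I_N -> nat) (s : {perm T}).

Lemma fixcount_cfun : exists theta : 'CF(G), forall s, theta s = (fixcount M s)%:~R.
Proof.
have [chi _ h] := @colouring_character T 'I_N predT.
exists chi => s; rewrite h /fixcount mulrz_nat; congr _%:R.
by apply: eq_card => f; rewrite !inE andbT.
Qed.

(** Convolution acts on an irreducible character by a scalar, which
[alt_char_trace] determines because the value at the identity is not 0. *)
Lemma alt_char_convolution a s : level T a ->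
  (\prod_(i < N) i`!)%:R * \sum_(t : {perm T}) fixcount M (s * t^-1)%g * alt_char a t =
  (\prod_i (a i)`!)%:R * alt_char a s.
Proof.
move=> ha; case: (boolP (injectiveb a)) => [/injectiveP inja|hinj]; last first.
  rewrite alt_char_noninj // [X in _ * X]big1 ?mulr0 // => t _.
  by rewrite alt_char_noninj // mulr0.
have [b [j hj]] := alt_char_irr inja ha.
have [theta htheta] := fixcount_cfun.
have [c hc] := irr_convolution theta j.
have key u : (\sum_(t : {perm T}) fixcount M (u * t^-1)%g * alt_char a t)%:~R =
    c * (alt_char a u)%:~R :> algC.
  rewrite hj mulrCA -hc ?inE // mulr_sumr rmorph_sum /= [RHS](reindex_inj invg_inj) /=.
  apply: eq_big => [x|t _]; first by rewrite inE.
  rewrite invgK rmorphM /= hj mulrCA -htheta; congr (_ * (_ * _)).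
  by rewrite -(cfunJ theta (u * t^-1)%g (in_setT u)) conjgE !mulgA mulVg mul1g.
apply/eqP; rewrite -(eqr_int algC) !rmorphM /= key; apply/eqP.
rewrite mulrA; congr (_ * _).
have := congr1 (fun z : int => z%:~R : algC) (alt_char_trace (eqP ha)).
rewrite /= !rmorphM /= -/(fixcount _ _) => h.
have h1 : ((alt_char a (1%g : {perm T}))%:~R : algC) != 0.
  by rewrite hj mulf_neq0 ?signr_eq0 ?irr1_neq0.
apply: (mulIf h1); rewrite -mulrA -key -h.
congr (_ * _%:~R); apply: eq_bigr => t _; congr (_ * _).
by rewrite mul1g /fixcount; congr _%:R; apply: eq_card => f; rewrite !inE fixesV.
Qed.

(** If ['chi_i] were orthogonal to all [alt_char a], then the polynomial
[\sum_s 'chi_i(s) p_s] times the Vandermonde polynomial would vanish, hence the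
first polynomial would.  Its coefficient at a squarefree monomial comes from
injective colourings, which only the identity fixes, so it is a multiple of
['chi_i 1].  The existence of an injective colouring is where [#|T| <= N] is
needed. *)
Lemma irr_is_alt_char (i : Iirr G) :
  exists a, [/\ injective a, level T a &
    exists b : bool, forall s, 'chi_i s = (-1) ^+ b * (alt_char a s)%:~R].
Proof.
pose P : {mpoly algC[N]} := \sum_(s : {perm T}) 'chi_i s *: power_poly N algC s.
have coefP a : (P * delta_poly N algC)@_[multinom a k | k < N] =
    \sum_(s : {perm T}) 'chi_i s * (alt_char a s)%:~R.
  rewrite /P mulr_suml raddf_sum /=; apply: eq_bigr => s _.
  by rewrite -scalerAl mcoeffZ coef_power_delta.
have hd : delta_poly N algC != 0.
  apply/eqP => /(congr1 (mcoeff [multinom (k : nat) | k < N])).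
  rewrite mcoeff0 coef_alternant (bigD1 1%g) //= odd_perm1 mul1r.
  rewrite (_ : [forall k, _]); last by apply/forallP => k; rewrite perm1.
  rewrite big1 => [|w hw].
    by rewrite addr0; apply/eqP; rewrite oner_eq0.
  case: forallP => h; last by rewrite mulr0.
  have e : w = 1%g by apply/permP => k; rewrite perm1; apply/val_inj/eqP/(h k).
  by rewrite e eqxx in hw.
(* An injective colouring; its content is a squarefree monomial. *)
pose f0 : {ffun T -> 'I_N} := [ffun x => widen_ord leTN (enum_rank x)].
have hf0 k : (content f0 k <= 1)%N.
  rewrite ffunE; apply/card_le1_eqP => x y; rewrite !inE !ffunE => /eqP <- /eqP.
  by move/(congr1 val) => /= e; apply/enum_rank_inj/val_inj.
have hP : P != 0.
  apply/eqP => /(congr1 (mcoeff [multinom (content f0 k) | k < N])).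
  rewrite mcoeff0 /P raddf_sum /= (bigD1 1%g) //= big1 => [|s hs].
    rewrite addr0 mcoeffZ /power_poly raddf_sum /=.
    rewrite (eq_bigr (fun f : {ffun T -> 'I_N} => ([multinom content f k | k < N] == [multinom content f0 k | k < N])%:R)) => [|f _].
      rewrite -natr_sum => /eqP; rewrite mulf_eq0 (negbTE (irr1_neq0 _)) /= pnatr_eq0.
      rewrite (bigD1 f0) ?eqxx //=.
      by apply/forallP => x; rewrite perm1.
    by rewrite (prod_content (fun i => 'X_i)) prod_mpolyX mcoeffX.
  rewrite mcoeffZ /power_poly raddf_sum /= big1 ?mulr0 // => f /forallP hf.
  rewrite (prod_content (fun i => 'X_i)) prod_mpolyX mcoeffX.
  case: eqP => // /mnmP h; case/eqP: hs; apply/permP => x; rewrite perm1.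
  have := hf0 (f x); have := h (f x); rewrite !mnmE => <-.
  by rewrite ffunE => /card_le1_eqP h1; apply: (h1 x (s x)); rewrite inE ?hf.
have hPD : P * delta_poly N algC != 0 by rewrite mulf_neq0.
(* Any exponent with non-zero coefficient would do; take the leading one. *)
pose a k : nat := mlead (P * delta_poly N algC) k.
have ha : \sum_(s : {perm T}) 'chi_i s * (alt_char a s)%:~R != 0.
  rewrite -coefP (_ : [multinom _ | _ < _] = mlead (P * delta_poly N algC)).
    by rewrite mleadc_eq0.
  by apply/mnmP => k; rewrite mnmE.
have hlev : level T a.
  apply: contraNT ha => h; rewrite big1 // => s _; by rewrite alt_char_level // mulr0.
have hinj : injective a.
  apply/injectiveP; apply: contraNT ha => h; rewrite big1 // => s _.
  by rewrite alt_char_noninj // mulr0.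
exists a; split=> //; have [b [j hj]] := alt_char_irr hinj hlev.
exists b => s; rewrite hj signrMK; congr ('chi_ _ s).
apply/eqP; apply: contraNT ha => hij.
rewrite (eq_bigr (fun s => (-1) ^+ b * ('chi_i s * ('chi_j s)^*))) => [|t _].
  rewrite -mulr_sumr; have := cfdot_irr i j; rewrite (negbTE hij) cfdotE => /eqP.
  rewrite mulf_eq0 invr_eq0 (negbTE (neq0CG _)) /= => /eqP h.
  rewrite (eq_bigl (fun x => x \in G)) => [|x]; last by rewrite inE.
  by rewrite h mulr0.
have -> : ('chi_j t)^* = 'chi_j t.
  by rewrite -[X in X^*](signrMK b) -hj rmorphM /= rmorph_sign conj_intr ?intr_int // hj signrMK.
by rewrite hj mulrCA.
Qed.

(** The left-hand side is the class function of [t] whose scalar product with each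
[alt_char b] is [alt_char b s], by orthogonality.  By completeness it is the sum of
['chi_i s * 'chi_i t] over all [i], and the second orthogonality relation
applies. *)
Lemma class_indicator s t :
  \sum_(f : {ffun T -> 'I_N} | fixes s f) alt_char (fun i => (i + content f i)%N) t =
  #|'C[s]%g|%:R *+ (s \in t ^: G)%g.
Proof.
have /fin_all_exists2[chi _ hchi] := fun f : {ffun T -> 'I_N} =>
  alt_cfun_exists T (fun i : 'I_N => (i + content f i)%N).
pose Phi := \sum_(f : {ffun T -> 'I_N} | fixes s f) chi f.
have hPhi u : Phi u = (\sum_(f : {ffun T -> 'I_N} | fixes s f) alt_char (fun i => (i + content f i)%N) u)%:~R.
  by rewrite sum_cfunE rmorph_sum; apply: eq_bigr => f _; rewrite hchi.
have hdot i : '[Phi, 'chi_i] = 'chi_i s.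
  have [a [inja ha [b hb]]] := irr_is_alt_char i.
  pose H (u : {perm T}) : int := (-1) ^+ b * alt_char a u.
  rewrite (cfdot_int hPhi (H := H)) => [|u]; last by rewrite hb rmorphM /= rmorph_sign.
  apply: (canLR (mulKf (fact_neq0 T))).
  rewrite hb.
  have -> : \sum_(u : {perm T}) (\sum_(f : {ffun T -> 'I_N} | fixes s f)
      alt_char (fun i => (i + content f i)%N) u) * H u =
     #|T|`!%:R * ((-1) ^+ b * alt_char a s).
    under eq_bigr => u _ do rewrite mulr_suml.
    rewrite exchange_big /= alt_char_sum.
    rewrite (eq_bigr (fun f : {ffun T -> 'I_N} => (-1) ^+ b * (
       (\sum_(w : 'S_N) (-1) ^+ w * [forall i, (w i + content f (w i))%N == a i]%:R) *+ #|T|`!))) => [|f _]; last first.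
      rewrite -(alt_char_orthogonality (fun i => (i + content f i)%N) (eqP ha)) mulr_sumr; apply: eq_bigr => u _.
      by rewrite /H mulrCA.
    rewrite -mulr_sumr mulrCA; congr (_ * _).
    rewrite sumrMnl -[LHS]mulr_natl; congr (_ * _).
    rewrite exchange_big /=; apply: eq_bigr => w _; rewrite -mulr_sumr; congr (_ * _).
    rewrite -natr_sum -sum1_card; congr _%:R.
    rewrite (reindex _ (onW_bij _ (comp_perm_bij T w))) /= big_mkcond [RHS]big_mkcond.
    apply: eq_bigr => f _; rewrite inE fixes_comp_perm.
    case: (fixes s f) => //=; rewrite (eq_forallb (P2 := fun i => (a i == content f i + w i)%N)).
      by case: ifP.
    by move=> k; rewrite content_comp_perm addnC eq_sym.
  by rewrite rmorphM /= mulrz_nat rmorphM /= rmorph_sign.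
apply/eqP; rewrite -(eqr_int algC) -hPhi {1}(cfun_sum_cfdot Phi) sum_cfunE.
have -> : (#|'C[s]%g|%:R *+ (s \in t ^: G)%g)%:~R = #|'C_G[s]%g|%:R *+ (s \in t ^: G)%g :> algC.
  by rewrite setTI; case: (s \in _); rewrite ?mulr1n ?mulr0n //= mulrz_nat.
rewrite -(second_orthogonality_relation s (in_setT t)); apply/eqP/eq_bigr => i _.
rewrite cfunE hdot; congr (_ * _).
have [a [_ _ [b ->]]] := irr_is_alt_char i.
by rewrite rmorphM /= rmorph_sign conj_intr ?intr_int.
Qed.

(** Convolve both sides of [class_indicator] with the number of fixed
colourings, term by term on the left. *)
Lemma class_sum_fixcount s t :
  (\prod_(i < N) i`!)%:R * (#|'C[s]%g|%:R * \sum_(u in (s ^: G)%g) fixcount M (t * u^-1)%g) =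
  \sum_(f : {ffun T -> 'I_N} | fixes s f)
     (\prod_(i < N) (i + content f i)`!)%:R * alt_char (fun i => (i + content f i)%N) t.
Proof.
have hl (f : {ffun T -> 'I_N}) : level T (fun i : 'I_N => (i + content f i)%N).
  by rewrite /level big_split /= sum_content addnC.
under [RHS]eq_bigr => f _ do rewrite -alt_char_convolution //.
rewrite -mulr_sumr; congr (_ * _); rewrite exchange_big /= mulr_sumr big_mkcond /=.
apply: eq_bigr => u _; rewrite -mulr_sumr class_indicator class_sym.
by case: ifP => _; rewrite ?mulr1n ?mulr0n ?mulr0 // mulrC.
Qed.
End ClassSums.

(** * Raising and lowering particles *)
Section Fermions.
Variable N : nat.
Implicit Types (a : {ffun 'I_N -> int}) (g : {ffun 'I_N -> int} -> int)
  (c : int -> int) (d : int) (m : nat).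

(** A vector of [N] integers is read as the positions of [N] particles. *)
Definition move a (k : 'I_N) d : {ffun 'I_N -> int} :=
  [ffun i => a i + (if i == k then d else 0)].

Definition skew g := forall a i j, i != j -> g [ffun k => a (tperm i j k)] = - g a.
Definition nonneg_supported g := forall a k, a k < 0 -> g a = 0.

(** The effect on coefficients of multiplication by the power sum of degree [m]. *)
Definition lower m g a : int := \sum_k g (move a k (- m%:Z)).
(** One particle moves by [d]; the weight depends on the position that it
leaves. *)
Definition weighted d c g a : int := \sum_k c (a k) * g (move a k d).

Fixpoint lowers (l : seq nat) : {ffun 'I_N -> int} -> int :=
  if l is m :: l' then lower m (lowers l') else @vacuum N.

(** The exponents of the diagonal term of the Vandermonde polynomial. *)
Definition sea : {ffun 'I_N -> int} := [ffun i : 'I_N => (i : nat)%:Z].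

Lemma skew_eq0 g a i j : skew g -> i != j -> a i = a j -> g a = 0.
Proof.
move=> hg hij e; have := hg a i j hij.
rewrite (_ : [ffun k => _] = a); first by lia.
by apply/ffunP => k; rewrite ffunE; case: tpermP => // ->.
Qed.

Lemma move_tperm a i j k d :
  move [ffun u => a (tperm i j u)] (tperm i j k) d = [ffun u => move a k d (tperm i j u)].
Proof.
by apply/ffunP => u; rewrite !ffunE (canF_eq (tpermK i j)).
Qed.

Lemma skew_vacuum : skew (@vacuum N).
Proof. by move=> a i j hij; rewrite vacuum_perm odd_tperm hij expr1 mulN1r. Qed.

Lemma skew_lower m g : skew g -> skew (lower m g).
Proof.
move=> hg a i j hij; rewrite /lower (reindex_inj (@perm_inj _ (tperm i j))) /= -sumrN.
by apply: eq_bigr => k _; rewrite move_tperm hg.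
Qed.

Lemma skew_weighted d c g : skew g -> skew (weighted d c g).
Proof.
move=> hg a i j hij; rewrite /weighted (reindex_inj (@perm_inj _ (tperm i j))) /= -sumrN.
by apply: eq_bigr => k _; rewrite move_tperm hg // ffunE tpermK mulrN.
Qed.

Lemma skew_lowers l : skew (lowers l).
Proof. by elim: l => [|m l IH]; [exact: skew_vacuum | exact: skew_lower]. Qed.

Lemma vacuum_notin a k : (forall j : 'I_N, a k != j%:Z) -> vacuum a = 0.
Proof.
move=> h; rewrite /vacuum (expand_det_row _ k) big1 // => j _.
by rewrite mxE (negbTE (h j)) mul0r.
Qed.

Lemma ns_vacuum : nonneg_supported (@vacuum N).
Proof. by move=> a k hk; apply: (@vacuum_notin _ k) => j; lia. Qed.

Lemma vacuum_large a k : N%:Z <= a k -> vacuum a = 0.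
Proof. by move=> hk; apply: (@vacuum_notin _ k) => j; have := ltn_ord j; lia. Qed.

Lemma vacuum_sea : vacuum sea = 1.
Proof.
rewrite /vacuum -[RHS](@det1 _ N); congr (\det _); apply/matrixP => i j.
by rewrite !mxE ffunE.
Qed.

Lemma ns_lower m g : nonneg_supported g -> nonneg_supported (lower m g).
Proof.
move=> hg a k hk; rewrite /lower big1 // => j _; apply: (hg _ k); rewrite ffunE.
by case: ifP; lia.
Qed.

Lemma ns_lowers l : nonneg_supported (lowers l).
Proof. by elim: l => [|m l IH]; [exact: ns_vacuum | exact: ns_lower]. Qed.

(** A particle at a negative position that the move would bring back to a
non-negative one has weight 0.  This keeps functions supported on non-negative
positions stable under [weighted d c] ([ns_weighted]). *)
Definition no_return d c := forall k, k < 0 -> 0 <= k + d -> c k = 0.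

Lemma ns_weighted d c g : no_return d c ->
  nonneg_supported g -> nonneg_supported (weighted d c g).
Proof.
move=> hc hg a k hk; rewrite /weighted big1 // => j _.
case: (eqVneq k j) => [<-|hkj].
  case: (lerP 0 (a k + d)) => h; first by rewrite hc ?mul0r.
  by rewrite (hg _ k) ?mulr0 // ffunE eqxx.
by rewrite (hg _ k) ?mulr0 // ffunE (negbTE hkj) addr0.
Qed.

Definition backdiff c m : int -> int := fun k => c k - c (k - m%:Z).

Lemma no_return_backdiff d c m : no_return d c -> no_return (d - m%:Z) (backdiff c m).
Proof. by move=> hc k hk hkd; rewrite /backdiff !hc //; lia. Qed.

(** Two moves of different particles commute.  If both act on the same particle,
then the weight is read before or after the step down, which is where the difference
[backdiff c m] comes from. *)
Lemma weighted_lower d c m g a :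
  weighted d c (lower m g) a =
  lower m (weighted d c g) a + weighted (d - m%:Z) (backdiff c m) g a.
Proof.
rewrite /weighted /lower.
under eq_bigr => k _ do rewrite mulr_sumr.
rewrite exchange_big /= -big_split /=; apply: eq_bigr => k _.
rewrite (bigD1 k) //= [in RHS](bigD1 k) //=.
have hm i j : move (move a i d) j (- m%:Z) = move (move a j (- m%:Z)) i d.
  by apply/ffunP => u; rewrite !ffunE addrAC.
have -> : move a k (d - m%:Z) = move (move a k (- m%:Z)) k d.
  by apply/ffunP => u; rewrite !ffunE; case: ifP; lia.
rewrite hm [X in _ + X](eq_bigr (fun j => c (move a k (- m%:Z) j) * g (move (move a k (- m%:Z)) j d))).
  rewrite /backdiff; have -> : move a k (- m%:Z) k = a k - m%:Z by rewrite ffunE eqxx.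
  ring.
by move=> j hj; rewrite hm [move a k _ j]ffunE (negbTE hj) addr0.
Qed.

(** For [N <= i + p] this is the sea with a particle lifted out of it, which leaves a
hole at [i]. *)
Definition raised (i : 'I_N) (p : nat) := move sea i p%:Z.

Lemma raised_self (i : 'I_N) p : raised i p i = (i : nat)%:Z + p%:Z.
Proof. by rewrite ffunE eqxx ffunE. Qed.

Lemma raised_other (i k : 'I_N) p : k != i -> raised i p k = (k : nat)%:Z.
Proof. by move=> h; rewrite ffunE (negbTE h) addr0 ffunE. Qed.

Lemma collision g a (k l : 'I_N) (e : int) : skew g -> k != l -> a k + e = a l -> g (move a k e) = 0.
Proof.
move=> hg hkl h; apply: (skew_eq0 (i := k) (j := l)) => //.
by rewrite !ffunE eqxx eq_sym (negbTE hkl) addr0.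
Qed.

(** The particle [k] would land below 0 or on an occupied position: it could avoid
this only by landing in the hole [i], but then [k = i + m >= i + p >= N]. *)
Lemma lower_raised_other g (i k : 'I_N) p m : skew g -> nonneg_supported g ->
  k != i -> (0 < m)%N -> (p <= m)%N -> (N <= i + p)%N ->
  g (move (raised i p) k (- m%:Z)) = 0.
Proof.
move=> hg hn hki hm hpm hip; have hk := raised_other p hki.
case: (ltnP k m) => hkm.
  by apply: (hn _ k); rewrite ffunE eqxx hk; lia.
have hl : (k - m < N)%N by apply: leq_ltn_trans (leq_subr _ _) (ltn_ord k).
have hli : Ordinal hl != i by apply/eqP => /(congr1 val) /=; have := ltn_ord k; lia.
apply: (collision (l := Ordinal hl)) => //.
  by apply/eqP => /(congr1 val) /=; lia.
by rewrite hk raised_other //=; lia.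
Qed.

(** The lifted particle lands strictly below its hole, hence on another particle or
below 0, and no other particle can fill the hole. *)
Lemma lower_raised_gt g (i : 'I_N) p m : skew g -> nonneg_supported g ->
  (p < m)%N -> (N <= i + p)%N -> lower m g (raised i p) = 0.
Proof.
move=> hg hn hpm hip; rewrite /lower big1 // => k _.
case: (eqVneq k i) => [->|hki]; last by apply: lower_raised_other => //; lia.
case: (ltnP (i + p) m) => him.
  by apply: (hn _ i); rewrite ffunE eqxx raised_self; lia.
have hl : (i + p - m < N)%N by have := ltn_ord i; lia.
have hli : Ordinal hl != i by apply/eqP => /(congr1 val) /=; lia.
apply: (collision (l := Ordinal hl)) => //; first by rewrite eq_sym.
by rewrite raised_self raised_other //=; lia.
Qed.

(** The lifted particle falls back into its hole; no other move is possible. *)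
Lemma lower_raised_eq g (i : 'I_N) p : skew g -> nonneg_supported g ->
  (0 < p)%N -> (N <= i + p)%N -> lower p g (raised i p) = g sea.
Proof.
move=> hg hn hp hip; rewrite /lower (bigD1 i) //= big1 => [|k hk].
  by rewrite addr0; congr g; apply/ffunP => u; rewrite !ffunE; case: ifP; lia.
exact: lower_raised_other.
Qed.

Lemma lower_sea g m : skew g -> nonneg_supported g -> (0 < m)%N -> lower m g sea = 0.
Proof.
move=> hg hn hm; rewrite /lower big1 // => k _.
case: (ltnP k m) => hkm.
  by apply: (hn _ k); rewrite !ffunE eqxx; lia.
have hl : (k - m < N)%N by apply: leq_ltn_trans (leq_subr _ _) (ltn_ord k).
apply: (collision (l := Ordinal hl)) => //.
  by apply/eqP => /(congr1 val) /=; lia.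
by rewrite !ffunE /=; lia.
Qed.

(** Here two particles share the position [i + p].  Moving one or the other gives
opposite values, and moving a third one leaves the collision. *)
Lemma weighted_raised_low g d c (i : 'I_N) p : skew g -> (0 < p)%N -> (i + p < N)%N ->
  weighted d c g (raised i p) = 0.
Proof.
move=> hg hp hip; pose j := Ordinal hip.
have hji : j != i by apply/eqP => /(congr1 val) /=; lia.
have hij : i != j by rewrite eq_sym.
have eij : raised i p i = raised i p j by rewrite raised_self raised_other //= PoszD.
rewrite /weighted (bigD1 i) //= (bigD1 j) //= big1 => [|k /andP[hki hkj]].
  rewrite addr0 eij -mulrDr.
  suff -> : g (move (raised i p) j d) = - g (move (raised i p) i d) by rewrite subrr mulr0.
  rewrite -(hg _ i j) //; congr g; apply/ffunP => u; rewrite [RHS]ffunE.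
  case: tpermP => [->|->|/eqP hui /eqP huj]; rewrite [LHS]ffunE [RHS]ffunE ?eqxx.
  - by rewrite (negbTE hij) (negbTE hji) eij.
  - by rewrite eij.
  - by rewrite (negbTE hui) (negbTE huj).
rewrite (skew_eq0 (i := i) (j := j)) ?mulr0 //.
by rewrite [LHS]ffunE [RHS]ffunE eq_sym (negbTE hki) eq_sym (negbTE hkj) eij.
Qed.

Lemma weighted_vacuum_return c (i : 'I_N) p : (N <= i + p)%N ->
  weighted (- p%:Z) c (@vacuum N) (raised i p) = c ((i : nat)%:Z + p%:Z).
Proof.
move=> hip; rewrite /weighted (bigD1 i) //= big1 => [|k hk].
  rewrite addr0 raised_self (_ : move _ _ _ = sea) ?vacuum_sea ?mulr1 //.
  by apply/ffunP => u; rewrite !ffunE; case: ifP; lia.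
rewrite (@vacuum_large _ i) ?mulr0 // ffunE eq_sym (negbTE hk) addr0 raised_self.
by rewrite -PoszD.
Qed.

Lemma weighted_vacuum_sea c : weighted 0 c (@vacuum N) sea = \sum_(j < N) c (j : nat)%:Z.
Proof.
apply: eq_bigr => j _; rewrite (_ : move _ _ _ = sea) ?vacuum_sea ?mulr1 ?ffunE //.
by apply/ffunP => u; rewrite !ffunE if_same addr0.
Qed.

Definition backdiffs := foldl backdiff.

(** Each [lower m] in front vanishes by [lower_raised_gt], so every part has to be
absorbed by the weight. *)
Lemma weighted_lowers_gt (l : seq nat) d c (i : 'I_N) p :
  no_return d c -> (N <= i + p)%N -> all (leq p.+1) l -> d = (sumn l)%:Z - p%:Z ->
  weighted d c (lowers l) (raised i p) = backdiffs c l ((i : nat)%:Z + p%:Z).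
Proof.
elim: l d c => [|m l IH] d c hc hip /=.
  by move=> _ ->; rewrite sub0r weighted_vacuum_return.
case/andP=> hm hl hd; rewrite weighted_lower lower_raised_gt //; first last.
- by apply: ns_weighted => //; exact: ns_lowers.
- by apply: skew_weighted; exact: skew_lowers.
rewrite add0r IH //; first exact: no_return_backdiff.
by rewrite hd PoszD; lia.
Qed.

Lemma weighted_lowers_one c p : no_return p%:Z c -> (0 < p)%N ->
  weighted p%:Z c (lowers [:: p]) sea = \sum_(j < N) backdiff c p (j : nat)%:Z.
Proof.
move=> hc hp; rewrite /= weighted_lower subrr weighted_vacuum_sea lower_sea ?add0r //.
  by apply: skew_weighted; exact: skew_vacuum.
by apply: ns_weighted => //; exact: ns_vacuum.
Qed.

(** Besides the term of [weighted_lowers_gt], the part [p] can drop the lifted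
particle back into its hole while the part [q] is absorbed by the weight.  If
[p = q], then the two parts can exchange these roles. *)
Lemma weighted_lowers_two c (i : 'I_N) p q : no_return q%:Z c -> (0 < p)%N -> (p <= q)%N ->
    (N <= i + p)%N ->
  weighted q%:Z c (lowers [:: q; p]) (raised i p) =
  backdiffs c [:: q; p] ((i : nat)%:Z + p%:Z) +
  (\sum_(j < N) backdiff c q (j : nat)%:Z) *+ (p == q).+1.
Proof.
move=> hc hp hpq hip; rewrite -/(lowers [:: q; p]).
have sk1 : skew (weighted q%:Z c (lowers [:: p])) by apply: skew_weighted; exact: skew_lowers.
have ns1 : nonneg_supported (weighted q%:Z c (lowers [:: p])).
  by apply: ns_weighted => //; exact: ns_lowers.
have hc1 : no_return 0 (backdiff c q) by rewrite -(subrr q%:Z); exact: no_return_backdiff.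
rewrite [lowers [:: q; p]]/= weighted_lower subrr -/(lowers [:: p]).
rewrite [X in _ + X]weighted_lower lower_raised_eq //; last 2 first.
- by apply: skew_weighted; exact: skew_vacuum.
- by apply: ns_weighted => //; exact: ns_vacuum.
rewrite weighted_vacuum_sea sub0r weighted_vacuum_return //.
case: (eqVneq p q) => [e|hne].
  subst q; rewrite lower_raised_eq // weighted_lowers_one // mulr2n.
  by rewrite addrA addrC.
rewrite lower_raised_gt //; last by lia.
by rewrite mulr1n; ring.
Qed.

End Fermions.

(** * Sums over the fixed colourings, cycle by cycle *)
Definition cycle_sizes (T : finType) (s : {perm T}) : seq nat :=
  map (fun C : {set T} => #|C|) (enum (porbits s)).

Section CycleSums.
Variables (V : nmodType) (M : nat).
Local Notation N := M.+1.

Definition single (k : 'I_N) (m : nat) : {ffun 'I_N -> nat} :=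
  [ffun i => if i == k then m else 0%N].

(** The sum of [F] over all contents obtained by colouring the cycles of lengths
[l] one after the other. *)
Fixpoint distribute (l : seq nat) (F : {ffun 'I_N -> nat} -> V) : V :=
  if l is m :: l' then \sum_k distribute l' (fun c => F (single k m + c))
  else F 0.

(** Labels outside [r] are frozen to [ord0], so that the functions that remain
are the labellings of the entries of [r]. *)
Lemma distribute_labels (B : finType) (w : B -> nat) (r : seq B) F : uniq r ->
  \sum_(phi : {ffun B -> 'I_N} | [forall b, (b \notin r) ==> (phi b == ord0)])
     F (\sum_(b <- r) single (phi b) (w b)) =
  distribute (map w r) F.
Proof.
elim: r F => [|b r IH] F /=.
  move=> _; rewrite (big_pred1 [ffun=> ord0]) ?big_nil // => phi.
  apply/forallP/eqP => [h|-> b]; last by rewrite ffunE.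
  by apply/ffunP => b; rewrite ffunE; apply/eqP; exact: (h b).
case/andP=> hb hr; rewrite (partition_big (fun phi : {ffun B -> 'I_N} => phi b) predT) //=.
apply: eq_bigr => k _; rewrite -IH //.
pose h (phi : {ffun B -> 'I_N}) : {ffun B -> 'I_N} := [ffun x => if x == b then k else phi x].
pose h' (phi : {ffun B -> 'I_N}) : {ffun B -> 'I_N} := [ffun x => if x == b then ord0 else phi x].
rewrite (reindex_onto h h') => [|phi /andP[_ /eqP e]]; last first.
  by apply/ffunP => x; rewrite !ffunE; case: eqP => // ->.
apply: eq_big => [phi|phi /andP[/andP[_ _] _]].
  rewrite [h phi b]ffunE eqxx eqxx andbT.
  apply/andP/forallP => [[/forallP h1 /eqP <-] x|h1].
    apply/implyP => hx; rewrite ffunE; case: (eqVneq x b) => // hxb.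
    by have := h1 x; rewrite inE negb_or hxb hx.
  split.
    apply/forallP => x; apply/implyP; rewrite inE negb_or => /andP[hx1 hx2].
    by rewrite ffunE (negbTE hx1); exact: (implyP (h1 x)).
  apply/eqP/ffunP => x; rewrite !ffunE; case: eqP => // ->.
  by apply/esym/eqP/(implyP (h1 b)).
rewrite big_cons [h phi b]ffunE eqxx; congr (F (_ + _)).
rewrite big_seq [RHS]big_seq; apply: eq_bigr => x hx; rewrite ffunE.
by case: eqP hx hb => // -> ->.
Qed.

(** A fixed colouring is constant on cycles. *)
Lemma sum_fixes_distribute (T : finType) (s : {perm T}) F :
  \sum_(f : {ffun T -> 'I_N} | fixes s f) F (content f) =
  distribute (cycle_sizes s) F.
Proof.
rewrite -distribute_labels ?enum_uniq //.
pose h (phi : {ffun {set T} -> 'I_N}) : {ffun T -> 'I_N} := [ffun x => phi (porbit s x)].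
pose h' (f : {ffun T -> 'I_N}) : {ffun {set T} -> 'I_N} :=
  [ffun C : {set T} => if [pick x in C | C \in porbits s] is Some x then f x else ord0].
have fix_porbit f x y : fixes s f -> y \in porbit s x -> f y = f x.
  move=> /forallP hf /porbitP[i ->]; elim: i => [|i IH]; first by rewrite perm1.
  by rewrite expgSr permM (eqP (hf _)).
rewrite (reindex_onto h h') => [|f hf]; last first.
  apply/ffunP => x; rewrite !ffunE; case: pickP => [y /andP[hy _]|/(_ x)].
    exact: fix_porbit hf hy.
  by rewrite porbit_id imset_f.
apply: eq_big => [phi|phi _].
  apply/andP/forallP => [[hf /eqP e] C|h1].
    apply/implyP; rewrite mem_enum => hC; rewrite -e ffunE.
    by case: pickP => // x /andP[_]; rewrite (negbTE hC).
  split.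
    apply/forallP => x; rewrite !ffunE; apply/eqP; congr (phi _).
    by apply/eqP; rewrite eq_porbit_mem (mem_porbit s 1).
  apply/eqP/ffunP => C; rewrite ffunE; case: pickP => [x /andP[hx hC]|hC].
    rewrite ffunE; congr (phi _); case/imsetP: hC hx => y _ -> hx.
    by apply/eqP; rewrite eq_porbit_mem.
  apply/esym/eqP; apply: (implyP (h1 C)); rewrite mem_enum; apply/negP => hC'.
  case/imsetP: (hC') hC => y _ e /(_ y); rewrite /= hC' e porbit_id.
  by [].
congr F; apply/ffunP => k; rewrite ffunE.
rewrite sum_ffunE big_enum /= -sum1_card (partition_big (porbit s) (mem (porbits s))) /=; last first.
  by move=> x _; rewrite imset_f.
apply: eq_bigr => C hC; rewrite ffunE eq_sym.
case/imsetP: hC => y _ ->.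
case: (eqVneq (phi (porbit s y)) k) => [e|hne].
  rewrite -sum1_card; apply: eq_bigl => x; rewrite inE ffunE eq_porbit_mem.
  case hx: (x \in porbit s y); rewrite ?andbF // andbT -e; apply/eqP; congr (phi _).
  by apply/eqP; rewrite eq_porbit_mem.
rewrite big1 // => x /andP[]; rewrite inE ffunE => /eqP e1 /eqP e2.
by move: hne; rewrite -e1 e2 eqxx.
Qed.

Lemma eq_distribute l F F' : F =1 F' -> distribute l F = distribute l F'.
Proof.
elim: l F F' => [|m l IH] F F' e /=; first exact: e.
by apply: eq_bigr => k _; apply: IH => c; exact: e.
Qed.

Lemma distribute_middle (l1 l2 : seq nat) m F :
  distribute (l1 ++ m :: l2) F = distribute (m :: l1 ++ l2) F.
Proof.
elim: l1 F => [|n l1 IH] F //=.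
under eq_bigr => k _ do rewrite IH /=.
rewrite exchange_big /=; apply: eq_bigr => k _; apply: eq_bigr => j _.
by apply: eq_distribute => c; rewrite addrCA.
Qed.

Lemma distribute_perm l l' F : perm_eq l l' -> distribute l F = distribute l' F.
Proof.
elim: l l' F => [|m l IH] l' F h; first by move/perm_size/esym/size0nil: h => ->.
have hm : m \in l' by rewrite -(perm_mem h) mem_head.
case/splitPr: hm h => l1 l2 h; rewrite distribute_middle /=; apply: eq_bigr => k _; apply: IH.
rewrite -(perm_cons m) (perm_trans h) //.
by rewrite -cat1s -(cat1s m (l1 ++ l2)) perm_catCA.
Qed.

End CycleSums.

Lemma lowers_distribute (M : nat) (l : seq nat) (b : {ffun 'I_M.+1 -> int}) :
  lowers l b = distribute l (fun c => vacuum [ffun i => b i - (c i)%:Z]).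
Proof.
elim: l b => [|m l IH] b /=.
  by congr vacuum; apply/ffunP => i; rewrite !ffunE subr0.
apply: eq_bigr => k _; rewrite IH; apply: eq_distribute => c.
congr vacuum; apply/ffunP => i; rewrite [LHS]ffunE [RHS]ffunE.
have -> : (single k m + c) i = (single k m i + c i)%N by rewrite ffunE.
by rewrite !ffunE PoszD; case: ifP; lia.
Qed.

Lemma alt_char_lowers (T : finType) (M : nat) (a : 'I_M.+1 -> nat) (s : {perm T}) l :
  perm_eq (cycle_sizes s) l ->
  alt_char a s = lowers l [ffun i => (a i)%:Z].
Proof.
move=> hl; rewrite lowers_distribute -(distribute_perm _ hl) -sum_fixes_distribute.
by apply: eq_bigr => f _; congr vacuum; apply/ffunP => i; rewrite !ffunE.
Qed.

(** [(k + 1) ... (k + m)], the factor of [\prod_i a_i!] gained when a particle at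
[k] is raised by [m]; it is cut off at negative positions in order that
[no_return] holds. *)
Definition rising (m : nat) (k : int) : int :=
  if 0 <= k then \prod_(r < m) (k + (r.+1)%:Z) else 0.

Lemma rising_nat (m k : nat) : rising m k%:Z * k`!%:R = (k + m)`!%:R.
Proof.
rewrite /rising /=; elim: m => [|m IH]; first by rewrite big_ord0 mul1r addn0.
rewrite big_ord_recr /= mulrAC IH addnS factS natrM mulrC; congr (_ * _).
by rewrite natz; lia.
Qed.

Lemma no_return_rising d m : no_return d (rising m).
Proof. by move=> k hk _; rewrite /rising leNgt hk. Qed.

(** The trivial weight, cut off in the same way. *)
Definition nonneg_indicator (k : int) : int := (0 <= k)%R%:R.

Lemma no_return_indicator d : no_return d nonneg_indicator.
Proof. by move=> k hk _; rewrite /nonneg_indicator leNgt hk. Qed.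

Lemma prod_fact_move (M : nat) (b : 'I_M.+1 -> nat) (c : 'I_M.+1 -> nat) j m :
  (forall i, c i = b i + (if i == j then m else 0))%N ->
  (\prod_i (c i)`!)%:R = rising m (b j)%:Z * (\prod_i (b i)`!)%:R.
Proof.
move=> h; rewrite (bigD1 j) //= [in RHS](bigD1 j) //= !natrM mulrA rising_nat.
rewrite h eqxx; congr (_ * _%:R); apply: eq_bigr => i /negbTE hi.
by rewrite h hi addn0.
Qed.

(** [class_sum_fixcount] and [class_indicator] for the cycle type [q, p]: the
colouring that fixes [s] has a colour [i] on the cycle of length [p] and a colour on
the other one.  Colours [i] with [i + p < N] contribute 0 by
[weighted_raised_low]. *)
Section TwoCycles.
Variables (T : finType) (M p q : nat).
Local Notation N := M.+1.
Local Notation G := [set: {perm T}]%G.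
Hypothesis leTN : (#|T| <= N)%N.
Implicit Types (s t : {perm T}).

Lemma class_sum_two s t l : (0 < p)%N ->
    perm_eq (cycle_sizes s) [:: q; p] -> perm_eq (cycle_sizes t) l ->
  #|'C[s]%g|%:R * \sum_(u in (s ^: G)%g) fixcount M (t * u^-1)%g =
  \sum_(i < N | (N <= i + p)%N) rising p (i : nat)%:Z *
     weighted q%:Z (rising q) (lowers l) (raised i p).
Proof.
move=> hp hs ht.
have hW : (\prod_(i < N) i`!)%:R != 0 :> int.
  by rewrite pnatr_eq0 -lt0n prodn_gt0 // => i; rewrite fact_gt0.
apply: (mulfI hW); rewrite class_sum_fixcount //.
rewrite (sum_fixes_distribute s (fun c => (\prod_(i < N) (i + c i)`!)%:R *
   alt_char (fun i => (i + c i)%N) t)) (distribute_perm _ hs) /= exchange_big /=.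
rewrite mulr_sumr [RHS]big_mkcond; apply: eq_bigr => i _.
transitivity ((\prod_(i < N) i`!)%:R * (rising p (i : nat)%:Z *
     weighted q%:Z (rising q) (lowers l) (raised i p))); last first.
  case: leqP => // h; rewrite weighted_raised_low ?mulr0 //.
  exact: skew_lowers.
rewrite /weighted !mulr_sumr; apply: eq_bigr => j _.
rewrite (alt_char_lowers _ ht).
rewrite (@prod_fact_move _ (fun k => k + (if k == i then p else 0))%N _ j q); last first.
  by move=> k; rewrite !ffunE; case: ifP; case: ifP; lia.
rewrite (@prod_fact_move _ (fun k => k : nat) _ i p) //.
rewrite (_ : raised i p j = (j + (if j == i then p else 0))%N%:Z); last first.
  by rewrite !ffunE; case: ifP; lia.
rewrite (_ : [ffun _ => _] = move (raised i p) j q); last first.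
  by apply/ffunP => k; rewrite !ffunE; case: ifP; case: ifP; lia.
ring.
Qed.

Lemma class_indicator_two s t l : (0 < p)%N ->
    perm_eq (cycle_sizes s) [:: q; p] -> perm_eq (cycle_sizes t) l ->
  #|'C[s]%g|%:R *+ (s \in t ^: G)%g =
  \sum_(i < N | (N <= i + p)%N)
     weighted q%:Z nonneg_indicator (lowers l) (raised i p) :> int.
Proof.
move=> hp hs ht; rewrite -(class_indicator leTN).
rewrite (sum_fixes_distribute s (fun c => alt_char (fun i => (i + c i)%N) t)).
rewrite (distribute_perm _ hs) /= exchange_big /=.
rewrite [RHS]big_mkcond; apply: eq_bigr => i _.
transitivity (weighted q%:Z nonneg_indicator (lowers l) (raised i p)); last first.
  case: leqP => // h; rewrite weighted_raised_low //.
  exact: skew_lowers.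
apply: eq_bigr => j _; rewrite (alt_char_lowers _ ht).
rewrite (_ : nonneg_indicator _ = 1) ?mul1r; last first.
  by rewrite /nonneg_indicator !ffunE; case: ifP.
congr (lowers _ _).
by apply/ffunP => k; rewrite !ffunE; case: ifP; case: ifP; lia.
Qed.
End TwoCycles.

(** * Class sums for one and two cycles *)
Lemma sum_ltn (n m : nat) : (m <= n)%N -> (\sum_(j < n) (j < m) = m)%N.
Proof.
move=> h; rewrite (eq_bigr (fun j : 'I_n => if (j < m)%N then 1%N else 0%N)) => [|j _].
  by rewrite -big_mkcond -(big_ord_widen n (fun=> 1%N) h) sum1_card card_ord.
by case: ifP.
Qed.

Section Evaluations.
Variables (T : finType) (M p q : nat).
Local Notation N := M.+1.
Local Notation G := [set: {perm T}]%G.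
Hypothesis leTN : (#|T| <= N)%N.
Hypothesis p_gt0 : (0 < p)%N.
Implicit Types (s t : {perm T}).

(** The number of fixed colourings of a product of two full cycles of length [m],
summed over one of them, up to the factor [m] (see [full_cycle_sum]). *)
Definition edge_sum (m : nat) : int := \sum_(j < N) backdiff (rising m) m (j : nat)%:Z.

(** The value at [N] of the polynomial [genus_numerator]
(see [horner_genus_numerator]). *)
Definition window (l : seq nat) : int :=
  \sum_(i < N | (N <= i + p)%N) rising p (i : nat)%:Z *
     backdiffs (rising q) l ((i : nat)%:Z + p%:Z).

Lemma class_sum_one s t :
    perm_eq (cycle_sizes s) [:: p] -> perm_eq (cycle_sizes t) [:: p] ->
  #|'C[s]%g|%:R * \sum_(u in (s ^: G)%g) fixcount M (t * u^-1)%g = edge_sum p.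
Proof.
move=> hs ht; rewrite /edge_sum -weighted_lowers_one //; last exact: no_return_rising.
have hW : (\prod_(i < N) i`!)%:R != 0 :> int.
  by rewrite pnatr_eq0 -lt0n prodn_gt0 // => i; rewrite fact_gt0.
apply: (mulfI hW); rewrite class_sum_fixcount //.
rewrite (sum_fixes_distribute s (fun c => (\prod_(i < N) (i + c i)`!)%:R *
   alt_char (fun i => (i + c i)%N) t)) (distribute_perm _ hs) /distribute.
rewrite mulr_sumr; apply: eq_bigr => i _.
rewrite (alt_char_lowers _ ht).
rewrite (@prod_fact_move _ (fun k => k : nat) _ i p); last first.
  by move=> k; rewrite addr0 ffunE.
rewrite (_ : [ffun _ => _] = move (sea N) i p); last first.
  by apply/ffunP => k; rewrite !ffunE; case: ifP; lia.
by rewrite /sea [in RHS]ffunE; ring.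
Qed.

Lemma sum_backdiff_indicator m : (m <= N)%N ->
  \sum_(j < N) backdiff nonneg_indicator m (j : nat)%:Z = m%:Z.
Proof.
move=> hm; rewrite (eq_bigr (fun j : 'I_N => ((j < m)%N : nat)%:R)) => [|j _].
  by rewrite -natr_sum natz sum_ltn.
rewrite /backdiff /nonneg_indicator; case: ltnP => h.
  by rewrite (_ : (0 <= _ - _)%R = false) ?subr0 //; lia.
by rewrite (_ : (0 <= _ - _)%R = true) ?subrr //; lia.
Qed.

Lemma class_indicator_one s t :
    perm_eq (cycle_sizes s) [:: p] -> perm_eq (cycle_sizes t) [:: p] -> (p <= N)%N ->
  #|'C[s]%g|%:R *+ (s \in t ^: G)%g = p%:Z.
Proof.
move=> hs ht hpN; rewrite -(class_indicator leTN).
rewrite (sum_fixes_distribute s (fun c => alt_char (fun i => (i + c i)%N) t)).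
rewrite (distribute_perm _ hs) /distribute.
transitivity (weighted p%:Z nonneg_indicator (lowers [:: p]) (sea N)).
  apply: eq_bigr => i _; rewrite (alt_char_lowers _ ht).
  rewrite (_ : nonneg_indicator _ = 1) ?mul1r; last first.
    by rewrite /nonneg_indicator !ffunE.
  congr (lowers _ _).
  by apply/ffunP => k; rewrite !ffunE; case: ifP; lia.
rewrite weighted_lowers_one //; last exact: no_return_indicator.
exact: sum_backdiff_indicator.
Qed.

Lemma card_edge : (p <= N)%N -> #|[pred i : 'I_N | (N <= i + p)%N]| = p.
Proof.
move=> hp; rewrite -sum1_card big_mkcond /=.
rewrite (reindex_inj rev_ord_inj) /=.
rewrite (eq_bigr (fun j : 'I_N => (j < p)%N : nat)) => [|j _]; last first.
  have hj := ltn_ord j; have -> : (rev_ord j \in [pred i : 'I_N | (N <= i + p)%N]) = (j < p)%N.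
    by rewrite inE /=; lia.
  by case: ltnP.
exact: sum_ltn.
Qed.

(** The sum of the differences telescopes, and [rising m] vanishes at the negative
positions. *)
Lemma edge_sum_tail m : (0 < m)%N -> (m <= N)%N ->
  edge_sum m = \sum_(i < N | (N <= i + m)%N) rising m (i : nat)%:Z.
Proof.
move=> hm0 hm; rewrite /edge_sum /backdiff big_split /= sumrN.
suff -> : \sum_(j < N) rising m ((j : nat)%:Z - m%:Z) =
    \sum_(j < N | ~~ (N <= j + m)%N) rising m (j : nat)%:Z.
  by rewrite (bigID (fun i : 'I_N => (N <= i + m)%N)) /= addrK.
apply/esym.
rewrite -(big_mkord (fun i => ~~ (N <= i + m)%N) (fun i => rising m i%:Z)).
rewrite -(big_mkord xpredT (fun i => rising m (i%:Z - m%:Z))) /=.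
rewrite [RHS](big_cat_nat (leq0n m) hm) /= [X in _ = X + _]big_nat_cond [X in _ = X + _]big1 => [|j /andP[/andP[_ h] _]]; last first.
  by rewrite /rising; case: ifP => //; lia.
rewrite add0r -[X in \sum_(X <= _ < _) _]add0n big_addn.
rewrite (big_cat_nat (leq0n (N - m)) (leq_subr m N)) /= [X in _ + X]big_nat_cond [X in _ + X]big1 => [|j /andP[/andP[h1 _] h2]]; last by lia.
rewrite addr0 big_nat_cond [RHS]big_nat_cond; apply: eq_big => [j|j _]; first by lia.
by congr rising; lia.
Qed.

(** The order of the centraliser comes out of the same calculation as the class
sum, with the trivial weight in place of [rising q]. *)
Lemma class_indicator_two_eq s t : (p <= q)%N -> (p + q <= N)%N ->
    perm_eq (cycle_sizes s) [:: q; p] -> perm_eq (cycle_sizes t) [:: q; p] ->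
  #|'C[s]%g|%:R *+ (s \in t ^: G)%g = p%:Z * (q%:Z *+ (p == q).+1).
Proof.
move=> hpq hN hs ht; rewrite (class_indicator_two leTN p_gt0 hs ht).
rewrite (eq_bigr (fun=> q%:Z *+ (p == q).+1)) => [|i hi].
  rewrite sumr_const card_edge; last by lia.
  by rewrite -mulr_natl natz.
rewrite weighted_lowers_two //; last exact: no_return_indicator.
rewrite sum_backdiff_indicator; last by lia.
have e (x : int) : 0 <= x -> nonneg_indicator x = 1.
  by move=> h; rewrite /nonneg_indicator h.
by rewrite /backdiffs /= /backdiff !e ?subrr ?add0r //; lia.
Qed.

Lemma class_sum_two_gt s t l :
    perm_eq (cycle_sizes s) [:: q; p] -> perm_eq (cycle_sizes t) l ->
    all (leq p.+1) l -> sumn l = (p + q)%N ->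
  #|'C[s]%g|%:R * \sum_(u in (s ^: G)%g) fixcount M (t * u^-1)%g = window l.
Proof.
move=> hs ht hl hsum; rewrite (class_sum_two leTN p_gt0 hs ht).
apply: eq_bigr => i hi; rewrite weighted_lowers_gt //; first exact: no_return_rising.
by rewrite hsum; lia.
Qed.

Lemma class_sum_two_eq s t : (p <= q)%N -> (p + q <= N)%N ->
    perm_eq (cycle_sizes s) [:: q; p] -> perm_eq (cycle_sizes t) [:: q; p] ->
  #|'C[s]%g|%:R * \sum_(u in (s ^: G)%g) fixcount M (t * u^-1)%g =
    window [:: q; p] + edge_sum p * (edge_sum q *+ (p == q).+1).
Proof.
move=> hpq hN hs ht; rewrite (class_sum_two leTN p_gt0 hs ht).
rewrite (edge_sum_tail p_gt0); last by lia.
rewrite mulr_suml -big_split /=; apply: eq_bigr => i hi.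
by rewrite weighted_lowers_two // ?mulrDr //; exact: no_return_rising.
Qed.
End Evaluations.

(** The inner sum over [C] does not depend on the choice of [u] in the class of
[s], so a double sum over [C] and the class may be taken in either order. *)
Lemma class_average (gT : finGroupType) (F : gT -> int) (C : {set gT}) s (h : int) :
    (forall x y : gT, F (x ^ y)%g = F x) ->
    (forall t x, t \in C -> (t ^ x)%g \in C) ->
    (forall t, t \in C -> #|'C[s]%g|%:R * \sum_(u in (s ^: [set: gT])%g) F (t * u^-1)%g = h) ->
  #|[set: gT]|%:R * \sum_(t in C) F (t * s^-1)%g = #|C|%:R * h.
Proof.
move=> hF hC hsum.
have -> : #|C|%:R * h = \sum_(t in C)
    #|'C[s]%g|%:R * \sum_(u in (s ^: [set: gT])%g) F (t * u^-1)%g.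
  by rewrite mulr_natl -sumr_const; apply: eq_bigr => t ht; rewrite hsum.
rewrite -mulr_sumr exchange_big /=.
rewrite [X in _ = _ * X](eq_bigr (fun=> \sum_(t in C) F (t * s^-1)%g)) => [|u hu]; last first.
  case/imsetP: hu => x _ ->.
  rewrite (reindex_inj (conjg_inj x)) /=; apply: eq_big => [t|t ht].
    by apply/idP/idP => ht; [rewrite -(conjgK x t); exact: hC | exact: hC].
  by rewrite -conjVg -conjMg hF.
rewrite sumr_const -[X in _ = _ * X]mulr_natl mulrA -natrM -index_cent1 setTI.
by rewrite (Lagrange (subsetT ('C[s])%g)).
Qed.

(** * Permutations of a disjoint union *)
(** [T] is the disjoint union of the images of [h1] and [h2]; [split] decides to
which part a point belongs. *)
Section Gluing.
Variables (T T1 T2 : finType) (h1 : T1 -> T) (h2 : T2 -> T) (split : T -> T1 + T2).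
Hypothesis split1 : forall u, split (h1 u) = inl u.
Hypothesis split2 : forall v, split (h2 v) = inr v.
Hypothesis splitK : forall x, (match split x with inl u => h1 u | inr v => h2 v end) = x.
Implicit Types (a : {perm T1}) (b : {perm T2}) (s : {perm T}).

Definition glue_fun (a : T1 -> T1) (b : T2 -> T2) x :=
  match split x with inl u => h1 (a u) | inr v => h2 (b v) end.

Lemma glue_funK a b : cancel (glue_fun a b) (glue_fun (a^-1)%g (b^-1)%g).
Proof.
move=> x; rewrite -[RHS]splitK /glue_fun; case: (split x) => [u|v].
  by rewrite split1 permK.
by rewrite split2 permK.
Qed.

Definition glue a b : {perm T} := perm (can_inj (glue_funK a b)).

Lemma glue1 a b u : glue a b (h1 u) = h1 (a u).
Proof. by rewrite permE /glue_fun split1. Qed.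

Lemma glue2 a b v : glue a b (h2 v) = h2 (b v).
Proof. by rewrite permE /glue_fun split2. Qed.

Lemma glue_ind (P : T -> Prop) : (forall u, P (h1 u)) -> (forall v, P (h2 v)) -> forall x, P x.
Proof. by move=> H1 H2 x; rewrite -[x]splitK; case: (split x). Qed.

Lemma glueM a b a' b' : (glue a b * glue a' b')%g = glue (a * a')%g (b * b')%g.
Proof.
apply/permP; apply: glue_ind => w; rewrite permM.
  by rewrite !glue1 permM.
by rewrite !glue2 permM.
Qed.

Lemma part1_inj : injective h1.
Proof. by move=> u u' e; have := split1 u; rewrite e split1 => -[]. Qed.

Lemma part2_inj : injective h2.
Proof. by move=> u u' e; have := split2 u; rewrite e split2 => -[]. Qed.

Lemma part12 u v : h1 u <> h2 v.
Proof. by move=> e; have := split1 u; rewrite e split2. Qed.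

Lemma glue_inj a b a' b' : glue a b = glue a' b' -> a = a' /\ b = b'.
Proof.
move=> e; split; apply/permP => w.
  by apply: part1_inj; rewrite -(glue1 a b) e glue1.
by apply: part2_inj; rewrite -(glue2 a b) e glue2.
Qed.

Lemma porbit_glue1 a b u : porbit (glue a b) (h1 u) = h1 @: porbit a u.
Proof.
have hi i : ((glue a b ^+ i) (h1 u) = h1 ((a ^+ i) u))%g.
  by elim: i => [|i IH]; rewrite ?perm1 // !expgSr !permM IH glue1.
apply/setP => x; apply/porbitP/imsetP => [[i ->]|[y /porbitP[i ->] ->]].
  by exists ((a ^+ i)%g u) => //; apply: mem_porbit.
by exists i.
Qed.

Lemma porbit_glue2 a b v : porbit (glue a b) (h2 v) = h2 @: porbit b v.
Proof.
have hi i : ((glue a b ^+ i) (h2 v) = h2 ((b ^+ i) v))%g.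
  by elim: i => [|i IH]; rewrite ?perm1 // !expgSr !permM IH glue2.
apply/setP => x; apply/porbitP/imsetP => [[i ->]|[y /porbitP[i ->] ->]].
  by exists ((b ^+ i)%g v) => //; apply: mem_porbit.
by exists i.
Qed.

Lemma cycle_sizes_glue a b :
  perm_eq (cycle_sizes (glue a b)) (cycle_sizes a ++ cycle_sizes b).
Proof.
pose f1 (C : {set T1}) := h1 @: C; pose f2 (C : {set T2}) := h2 @: C.
have card1 C : #|f1 C| = #|C| by rewrite card_imset //; exact: part1_inj.
have card2 C : #|f2 C| = #|C| by rewrite card_imset //; exact: part2_inj.
suff h : perm_eq (enum (porbits (glue a b))) (map f1 (enum (porbits a)) ++ map f2 (enum (porbits b))).
  apply: perm_trans (perm_map _ h) _; rewrite map_cat -!map_comp.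
  by rewrite (eq_map card1) (eq_map card2).
apply: uniq_perm; first exact: enum_uniq.
  rewrite cat_uniq !map_inj_uniq ?enum_uniq ?andbT /=; last 2 first.
  - exact: imset_inj part2_inj.
  - exact: imset_inj part1_inj.
  apply/hasPn => X /mapP[C]; rewrite mem_enum => /imsetP[v _ ->] ->.
  apply/mapP => -[D]; rewrite mem_enum => /imsetP[u _ ->].
  move/setP/(_ (h2 v)); rewrite imset_f ?porbit_id // => /esym/imsetP[u' _ e].
  by case: (part12 (esym e)).
move=> C; rewrite mem_cat mem_enum; apply/imsetP/orP => [[x _ ->]|].
  rewrite -[x]splitK; case: (split x) => [u|v]; [left|right].
    by rewrite porbit_glue1 map_f // mem_enum imset_f.
  by rewrite porbit_glue2 map_f // mem_enum imset_f.
case=> /mapP[D]; rewrite mem_enum => /imsetP[w _ ->] ->.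
  by exists (h1 w); rewrite ?porbit_glue1.
by exists (h2 w); rewrite ?porbit_glue2.
Qed.

(** A permutation that maps a finite subset into itself maps it onto itself, hence
also preserves the complement. *)
Lemma glue_restrict s : (forall u, exists u', s (h1 u) = h1 u') ->
  exists a b, s = glue a b.
Proof.
move=> hs.
have hs' u : exists u', s (h1 u') = h1 u.
  have sub : s @: (h1 @: T1) \subset h1 @: T1.
    apply/subsetP => _ /imsetP[_ /imsetP[v _ ->] ->].
    by have [v' ->] := hs v; exact: imset_f.
  have : h1 u \in s @: (h1 @: T1).
    have /eqP -> : s @: (h1 @: T1) == h1 @: T1.
      by rewrite eqEcard sub (card_imset _ (@perm_inj _ s)) leqnn.
    exact: imset_f.
  by case/imsetP => _ /imsetP[v _ ->] ->; exists v.
have hs2 v : exists v', s (h2 v) = h2 v'.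
  have := splitK (s (h2 v)); case: (split _) => [u|v'] e; last by exists v'.
  have [u' e'] := hs' u; rewrite -e' in e.
  by case: (part12 (perm_inj e)).
pose fa u := if split (s (h1 u)) is inl u' then u' else u.
pose fb v := if split (s (h2 v)) is inr v' then v' else v.
have ha u : h1 (fa u) = s (h1 u) by rewrite /fa; have [u' ->] := hs u; rewrite split1.
have hb v : h2 (fb v) = s (h2 v) by rewrite /fb; have [v' ->] := hs2 v; rewrite split2.
have ia : injective fa.
  by move=> u u' e; apply/part1_inj/(@perm_inj _ s); rewrite -!ha e.
have ib : injective fb.
  by move=> u u' e; apply/part2_inj/(@perm_inj _ s); rewrite -!hb e.
exists (perm ia), (perm ib); apply/permP; apply: glue_ind => w.
  by rewrite glue1 permE ha.
by rewrite glue2 permE hb.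
Qed.
End Gluing.

(** A fixed colouring is a free choice of a colour for each cycle. *)
Lemma fixcount_cycles (T : finType) (M : nat) (s : {perm T}) :
  fixcount M s = (M.+1 ^ #|porbits s|)%:R.
Proof.
have -> : #|porbits s| = size (cycle_sizes s) by rewrite size_map -cardE.
have -> : fixcount M s = \sum_(f : {ffun T -> 'I_M.+1} | fixes s f) 1.
  by rewrite /fixcount -sumr_const; apply: eq_bigl => f; rewrite inE.
rewrite (@sum_fixes_distribute int M T s (fun=> 1)).
elim: (cycle_sizes s) => [|m l IH] //=.
by rewrite (eq_bigr _ (fun i _ => IH)) sumr_const card_ord expnS mulnC natrM mulr_natr.
Qed.

Lemma cycle_sizes_gt0 (T : finType) (s : {perm T}) : all (leq 1) (cycle_sizes s).
Proof.
apply/allP => k /mapP[C]; rewrite mem_enum => /imsetP[x _ ->] ->.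
by rewrite lt0n card_porbit_neq0.
Qed.

Lemma sumn_cycle_sizes (T : finType) (s : {perm T}) : sumn (cycle_sizes s) = #|T|.
Proof.
rewrite sumnE big_map big_enum /= -sum1_card (partition_big (porbit s) (mem (porbits s))) /=; last first.
  by move=> x _; rewrite imset_f.
apply: eq_bigr => C /imsetP[y _ ->]; rewrite -sum1_card; apply: eq_bigl => x.
by rewrite -eq_porbit_mem.
Qed.

Lemma cycle_sizes_card0 (T : finType) (s : {perm T}) : #|T| = 0%N -> cycle_sizes s = [::].
Proof.
have := sumn_cycle_sizes s; have := cycle_sizes_gt0 s.
by case: (cycle_sizes s) => //= k ks /andP[hk _] <- h; move: hk; lia.
Qed.

Lemma cycle_sizes_one (T : finType) (s : {perm T}) :
  size (cycle_sizes s) = 1%N -> cycle_sizes s = [:: #|T|].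
Proof.
have := sumn_cycle_sizes s; case: (cycle_sizes s) => [|k [|? ?]] //=.
by rewrite addn0 => ->.
Qed.

Lemma cycle_sizes_conj (T : finType) (s t : {perm T}) :
  perm_eq (cycle_sizes (s ^ t)%g) (cycle_sizes s).
Proof.
(* Conjugation by [t] is gluing along the bijection [t], with an empty second part. *)
pose h2 (v : void) : T := match v with end.
pose split x : T + void := inl ((t^-1)%g x).
have split1 u : split (t u) = inl u by rewrite /split permK.
have split2 v : split (h2 v) = inr v by case: v.
have splitK x : (match split x with inl u => t u | inr v => h2 v end) = x.
  by rewrite /= permKV.
have -> : (s ^ t)%g = glue split1 split2 splitK s 1%g.
  apply/permP => x; rewrite -[x](permKV t); move: ((t^-1)%g x) => y.
  by rewrite glue1 conjgE !permM permK.
apply: perm_trans (cycle_sizes_glue _ _ _ _ _) _.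
by rewrite [cycle_sizes (1%g : {perm void})]cycle_sizes_card0 ?cats0 // card_void.
Qed.

Lemma exists_full_cycle m : exists c : 'S_m.+1, cycle_sizes c = [:: m.+1].
Proof.
exists (perm (can_inj (@ordSK m.+1))).
set c := perm _.
have hc (x : 'I_m.+1) : x \in porbit c ord0.
  apply/porbitP; exists x; apply: val_inj.
  suff h i : (i <= m)%N -> val ((c ^+ i)%g ord0) = i by rewrite h // -ltnS.
  elim: i => [|i IH] hi; first by rewrite perm1.
  by rewrite expgSr permM permE /= IH ?modn_small // ltnW.
have h1 : porbits c = [set porbit c ord0].
  apply/setP => C; rewrite inE; apply/imsetP/eqP => [[x _ ->]|->]; last by exists ord0.
  by apply/eqP; rewrite eq_porbit_mem.
rewrite -[X in [:: X]](card_ord m.+1); apply: cycle_sizes_one.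
by rewrite /cycle_sizes size_map -cardE h1 cards1.
Qed.

(** The polynomial of an empty cycle class would be 0, so the class of every
partition has to be shown non-empty. *)
Lemma exists_cycle_sizes (l : seq nat) : all (leq 1) l ->
  exists s : 'S_(sumn l), perm_eq (cycle_sizes s) l.
Proof.
elim: l => [|m l IH] /=.
  by move=> _; exists 1%g; rewrite cycle_sizes_card0 // card_ord.
case/andP => hm /IH[s hs]; case: m hm => // m _.
have [c hc] := exists_full_cycle m.
have splitE (x : 'I_(m.+1 + sumn l)) :
   (match split x with inl u => lshift _ u | inr v => rshift _ v end) = x.
  exact: (@splitK m.+1 (sumn l) x).
exists (glue (fun u => @unsplitK m.+1 (sumn l) (inl u)) (fun v => @unsplitK m.+1 (sumn l) (inr v)) splitE c s).
by apply: perm_trans (cycle_sizes_glue _ _ _ _ _) _; rewrite hc /= perm_cons.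
Qed.

(** * Permutations that preserve a cycle *)
Lemma cycle_sizesV (T : finType) (s : {perm T}) : cycle_sizes (s^-1)%g = cycle_sizes s.
Proof. by rewrite /cycle_sizes porbitsV. Qed.

Lemma fixcountJ (T : finType) (M : nat) (s t : {perm T}) :
  fixcount M (s ^ t)%g = fixcount M s.
Proof.
have h (u : {perm T}) : #|porbits u| = size (cycle_sizes u) by rewrite size_map -cardE.
by rewrite !fixcount_cycles !h (perm_size (cycle_sizes_conj s t)).
Qed.

(** The constant [z] is not 0, so [C] is a single conjugacy class, and [z] is the
order of the centraliser of [s]. *)
Lemma card_conj_class (gT : finGroupType) (C : {set gT}) s (z : int) :
    s \in C -> (forall t x, t \in C -> (t ^ x)%g \in C) -> z != 0 ->
    (forall t, t \in C -> #|'C[s]%g|%:R *+ (s \in t ^: [set: gT])%g = z) ->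
  z * #|C|%:R = #|[set: gT]|%:R.
Proof.
move=> hs hC hz h.
have -> : C = (s ^: [set: gT])%g.
  apply/setP => t; apply/idP/idP => [ht|]; last by case/imsetP => x _ ->; exact: hC.
  have := h t ht; rewrite class_sym; case: (t \in _) => //.
  by rewrite mulr0n => e; rewrite -e eqxx in hz.
rewrite -(h s hs) (class_refl [set: gT]%G s) mulr1n -natrM -index_cent1 setTI.
by rewrite (Lagrange (subsetT ('C[s])%g)).
Qed.

Section OneCycle.
Variables (T : finType) (M : nat).
Hypothesis leTM : (#|T| <= M.+1)%N.
Hypothesis T_gt0 : (0 < #|T|)%N.
Implicit Types s t : {perm T}.

(** [class_sum_one], divided by the number of full cycles, which
[class_indicator_one] determines. *)
Lemma full_cycle_sum s : size (cycle_sizes s) = 1%N ->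
  #|T|%:Z * \sum_(t : {perm T} | size (cycle_sizes t) == 1%N) fixcount M (t * s)%g =
  edge_sum M #|T|.
Proof.
move=> hs; pose C := [set t : {perm T} | size (cycle_sizes t) == 1%N].
have hC t x : t \in C -> (t ^ x)%g \in C.
  by rewrite !inE (perm_size (cycle_sizes_conj t x)).
have sizeC t : t \in C -> perm_eq (cycle_sizes t) [:: #|T|].
  by rewrite inE => /eqP/cycle_sizes_one ->.
have hsC : (s^-1)%g \in C by rewrite inE cycle_sizesV hs.
have nz : #|T|%:Z != 0 by lia.
have avg := @class_average _ (fixcount M) C (s^-1)%g (edge_sum M #|T|) (@fixcountJ T M) hC
  (fun t ht => class_sum_one leTM T_gt0 (sizeC _ hsC) (sizeC _ ht)).
have card := card_conj_class hsC hC nz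
  (fun t ht => class_indicator_one leTM T_gt0 (sizeC _ hsC) (sizeC _ ht) leTM).
have nzG : #|[set: {perm T}]|%:R != 0 :> int.
  by rewrite pnatr_eq0 -lt0n cardG_gt0.
apply: (mulfI nzG); rewrite -[in RHS]card mulrCA -mulrA -avg; congr (_ * (_ * _)).
by apply: eq_big => [t|t _]; rewrite ?inE ?invgK.
Qed.
End OneCycle.

Section Restriction.
Variables (T : finType) (C : {set T}).
Let T1 := {x | x \in C}.
Let T2 := {x | x \notin C}.

Definition side (x : T) : T1 + T2 :=
  match boolP (x \in C) with
  | AltTrue h => inl (exist _ x h)
  | AltFalse h => inr (exist _ x h)
  end.

Lemma side1 (u : T1) : side (val u) = inl u.
Proof.
rewrite /side; case: {-}_ / boolP => h; first by congr inl; apply: val_inj.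
by case/negP: h; exact: valP.
Qed.

Lemma side2 (v : T2) : side (val v) = inr v.
Proof.
rewrite /side; case: {-}_ / boolP => h; last by congr inr; apply: val_inj.
by case/negP: (valP v).
Qed.

Lemma sideK x : (match side x with inl u => val u | inr v => val v end) = x.
Proof. by rewrite /side; case: {-}_ / boolP. Qed.

Local Notation glueC := (glue side1 side2 sideK).

Definition preserves (s : {perm T}) := [forall x in C, s x \in C].

Lemma preserves_glue a b : preserves (glueC a b).
Proof.
apply/forall_inP => x hx; have := glue1 side1 side2 sideK a b (exist _ x hx).
by move=> /= ->; exact: valP.
Qed.

Lemma preserves_glued s : preserves s -> exists a b, s = glueC a b.
Proof.
move/forall_inP => h; apply: glue_restrict => u.
by exists (exist _ (s (val u)) (h _ (valP u))).
Qed.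

(** Otherwise [C] would be a union of cycles of [s], all longer than [#|C|]. *)
Lemma not_preserves_long (s : {perm T}) : (0 < #|C|)%N ->
  all (leq #|C|.+1) (cycle_sizes s) -> ~~ preserves s.
Proof.
move=> hC hs; apply/negP => /preserves_glued[a [b e]].
move: hs; rewrite e (perm_all _ (cycle_sizes_glue _ _ _ _ _)) all_cat => /andP[+ _].
have := sumn_cycle_sizes a; rewrite card_sig (eq_card (B := C)) // => <-.
have : cycle_sizes a != [::].
  apply/eqP => h; have := sumn_cycle_sizes a; rewrite h card_sig (eq_card (B := C)) //=.
  by move: hC; lia.
by case: (cycle_sizes a) => //= k l _ /andP[]; lia.
Qed.

Variables (M : nat) (g : {perm T}).
Hypothesis leTM : (#|T| <= M.+1)%N.
Hypothesis C_gt0 : (0 < #|C|)%N.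
Hypothesis C_lt : (#|C| < #|T|)%N.
Hypothesis g_preserves : preserves g.
Hypothesis g_sizes : perm_eq (cycle_sizes g) [:: (#|T| - #|C|)%N; #|C|].

Let cardT1 : #|{: T1}| = #|C|.
Proof. by rewrite card_sig; apply: eq_card. Qed.

Let cardT2 : #|{: T2}| = (#|T| - #|C|)%N.
Proof.
rewrite card_sig -(cardC C) addKn; apply: eq_card => x.
by rewrite !inE.
Qed.

Lemma glue_two_cycles a b :
  perm_eq (cycle_sizes (glueC a b)) [:: (#|T| - #|C|)%N; #|C|] =
  (size (cycle_sizes a) == 1%N) && (size (cycle_sizes b) == 1%N).
Proof.
rewrite (permPl (cycle_sizes_glue _ _ _ _ _)).
apply/idP/andP => [h|[/eqP/cycle_sizes_one -> /eqP/cycle_sizes_one ->]]; last first.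
  by rewrite cardT1 cardT2 (perm_catC [:: _] [:: _]).
have := perm_size h; rewrite size_cat /=.
have : size (cycle_sizes a) != 0%N.
  apply/eqP => /size0nil e; have := sumn_cycle_sizes a.
  by rewrite e cardT1 /= => h0; move: C_gt0; rewrite -h0.
have : size (cycle_sizes b) != 0%N.
  apply/eqP => /size0nil e; have := sumn_cycle_sizes b.
  by rewrite e cardT2 /= => h0; move: C_lt; rewrite -subn_gt0 -h0.
by move=> *; split; lia.
Qed.

(** A permutation that preserves the cycle [C] of [g] restricts to [C] and to its
complement.  With only two cycles in all, it is a full cycle on each part, and the
number of fixed colourings is multiplicative. *)
Lemma disconnected_sum :
  #|C|%:Z * (#|T| - #|C|)%N%:Z *
  \sum_(t : {perm T} | perm_eq (cycle_sizes t) [:: (#|T| - #|C|)%N; #|C|] && preserves t)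
     fixcount M (t * g)%g = edge_sum M #|C| * edge_sum M (#|T| - #|C|)%N.
Proof.
have [g1 [g2 eg]] := preserves_glued g_preserves.
have /andP[/eqP s1 /eqP s2] : (size (cycle_sizes g1) == 1%N) && (size (cycle_sizes g2) == 1%N).
  by rewrite -glue_two_cycles -eg.
have e1 := @full_cycle_sum _ M _ _ g1 s1; rewrite cardT1 in e1.
have e2 := @full_cycle_sum _ M _ _ g2 s2; rewrite cardT2 in e2.
rewrite -e1; try lia; rewrite -e2; try lia.
rewrite mulrACA; congr (_ * _).
rewrite mulr_suml; under [RHS]eq_bigr => a _ do rewrite mulr_sumr.
rewrite pair_big /=.
pose G (u : {perm T1} * {perm T2}) := glueC u.1 u.2.
rewrite (eq_bigl (fun t => t \in G @: [set u | (size (cycle_sizes u.1) == 1%N) && (size (cycle_sizes u.2) == 1%N)])).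
  rewrite big_imset /=; last first.
    by move=> [a b] [a' b'] _ _ /glue_inj[/= -> ->].
  apply: eq_big => [u|u _]; first by rewrite inE.
  rewrite /G eg glueM !fixcount_cycles -natrM -expnD; congr ((_ ^ _)%:R).
  have h (X : finType) (w : {perm X}) : #|porbits w| = size (cycle_sizes w) by rewrite size_map -cardE.
  by rewrite !h (perm_size (cycle_sizes_glue _ _ _ _ _)) size_cat.
move=> t; apply/andP/imsetP => [[h /preserves_glued[a [b e]]]|[[a b]]].
  by exists (a, b); rewrite // inE /= -glue_two_cycles -e.
by rewrite inE /= -glue_two_cycles => h ->; split; rewrite // preserves_glue.
Qed.

End Restriction.

Lemma two_cycles_split (T : finType) (g : {perm T}) p q :
  perm_eq (cycle_sizes g) [:: q; p] ->
  exists x, #|porbit g x| = p /\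
    forall y z, y \notin porbit g x -> z \notin porbit g x -> z \in porbit g y.
Proof.
move=> hg.
have : p \in cycle_sizes g by rewrite (perm_mem hg) !inE eqxx orbT.
case/mapP => C; rewrite mem_enum => hC hp; case/imsetP: (hC) => x _ eC.
exists x; rewrite -eC; split=> // y z hy hz.
have h2 : #|porbits g :\ C| = 1%N.
  have := cardsD1 C (porbits g); rewrite hC.
  have -> : #|porbits g| = 2 by rewrite cardE -(size_map (fun C : {set T} => #|C|)) (perm_size hg).
  by move=> e2; apply/eqP; rewrite -eqSS -add1n -e2.
have hm u : u \notin C -> porbit g u \in porbits g :\ C.
  move=> hu; rewrite !inE imset_f // andbT; apply: contraNneq hu => <-.
  exact: porbit_id.
case/eqP/cards1P: h2 => D hD.
have := hm _ hy; have := hm _ hz; rewrite hD !inE => /eqP e1 /eqP e2.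
by rewrite -eq_porbit_mem e1 e2.
Qed.

(** The only subsets preserved by [g] are its two cycles, besides the trivial
ones. *)
Lemma transitive_two_cycles (T : finType) (g s : {perm T}) x :
    (exists y, y \notin porbit g x) ->
    (forall y z, y \notin porbit g x -> z \notin porbit g x -> z \in porbit g y) ->
  [transitive <<[set s; g]>>%g, on [set: T] | 'P] = ~~ preserves (porbit g x) s.
Proof.
move=> [y0 hy0] hC; set H := <<_>>%g; set C := porbit g x in hy0 hC *.
have sH : s \in H by apply: mem_gen; rewrite !inE eqxx.
have gH : g \in H by apply: mem_gen; rewrite !inE eqxx orbT.
have gorb u v : v \in porbit g u -> v \in orbit 'P H u.
  case/porbitP => i ->; apply/orbitP; exists (g ^+ i)%g => //.
  exact: groupX.
apply/idP/idP => [/imsetP[u _ hu]|/forall_inPn[u hu hsu]].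
  apply/negP => /forall_inP hs.
  have stab h : h \in H -> forall v, v \in C -> h v \in C.
    move=> hh v hv; suff: h \in ('N(C | 'P))%g.
      by move/astabs_act => /(_ v); rewrite hv.
    move: h hh; apply/subsetP; rewrite gen_subG; apply/subsetP => h.
    rewrite !inE => /orP[] /eqP -> ; apply/andP; split=> //; apply/subsetP => w hw; rewrite inE /= apermE.
      exact: hs.
    by have := hw; rewrite /C -!eq_porbit_mem -[g w]/((g ^+ 1)%g w) porbit_perm.
  have xorb : orbit 'P H x = [set: T].
    by rewrite hu; apply/eqP; rewrite orbit_eq_mem -hu inE.
  have := in_setT y0; rewrite -xorb => /orbitP[h hh e].
  by move: hy0; rewrite -e (stab h hh) // porbit_id.
apply/imsetP; exists x; rewrite ?inE //.
apply/esym/setP => v; rewrite inE.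
have uorb : u \in orbit 'P H x by apply: gorb.
have suorb : s u \in orbit 'P H x.
  apply: orbit_trans uorb; exact: mem_orbit.
case: (boolP (v \in C)) => hv; first exact: gorb.
by apply: orbit_trans suorb; apply: gorb; exact: hC.
Qed.

Lemma min_part_le mu m : m \in mu -> (min_part mu <= m)%N.
Proof.
rewrite /min_part; elim: mu (head 0 mu) => // k mu IH d; rewrite inE /= geq_min.
by case/orP => [/eqP ->|/IH ->]; rewrite ?leqnn ?orbT.
Qed.

Lemma cycle_classP n mu (s : 'S_n) : is_partition n mu ->
  (s \in cycle_class n mu) = perm_eq (cycle_sizes s) mu.
Proof.
case/and3P => hs _ _; rewrite inE /cycle_type -/(cycle_sizes s); apply/eqP/idP => [<-|h].
  by rewrite perm_sym perm_sort.
apply: (sorted_eq (leT := geq)) => //.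
- by move=> a b c /= h1 h2; apply: leq_trans h2 h1.
- by move=> a b /= h'; apply/eqP; rewrite eqn_leq andbC.
- by apply: sort_sorted => a b; exact: leq_total.
- by rewrite perm_sort.
Qed.

(** If all parts of [mu] exceed [p], then no [alpha] preserves a cycle of [gamma]
and the sum is the full class sum.  If [mu] is [q, p], then the class sum exceeds
[window] by a product of two edge sums, and [disconnected_sum] is the same product:
the factors agree by the order of the centraliser. *)
Theorem connected_sum n p mu (gamma : 'S_n) M :
    (0 < p)%N -> (p <= n - p)%N -> perm_eq (cycle_sizes gamma) [:: (n - p)%N; p] ->
    is_partition n mu -> mu = two_parts n p \/ (p + 1 <= min_part mu)%N -> (n <= M.+1)%N ->
  n`!%:R * \sum_(alpha in cycle_class n mu | generates_transitive alpha gamma)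
     fixcount M (alpha * gamma)%g =
  #|cycle_class n mu|%:R * window M p (n - p) mu.
Proof.
move=> hp hpn hg hmu hcase hn.
have [x [hxp hx]] := two_cycles_split hg.
set C := porbit gamma x in hxp hx.
have ltpn : (p < n)%N by lia.
have leTN : (#|'I_n| <= M.+1)%N by rewrite card_ord.
have hC0 : exists y, y \notin C.
  apply/existsP; rewrite -negb_forall; apply/negP => /forallP h.
  have : #|C| = #|'I_n| by apply: eq_card => y; rewrite h.
  by rewrite hxp card_ord; lia.
have gC : preserves C gamma.
  by apply/forall_inP => y; rewrite /C -!eq_porbit_mem -[gamma y]/((gamma ^+ 1)%g y) porbit_perm.
have clJ (t : 'S_n) y : t \in cycle_class n mu -> (t ^ y)%g \in cycle_class n mu.
  by rewrite !cycle_classP //; apply: perm_trans; exact: cycle_sizes_conj.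
(* The class sums run over products [alpha * u^-1], hence [u] in the class of [gamma^-1]. *)
have hgV : perm_eq (cycle_sizes gamma^-1) [:: (n - p)%N; p] by rewrite cycle_sizesV.
have avg h : (forall t, t \in cycle_class n mu ->
   #|'C[gamma^-1]%g|%:R * \sum_(u in (gamma^-1 ^: [set: 'S_n])%g) fixcount M (t * u^-1)%g = h) ->
  n`!%:R * \sum_(t in cycle_class n mu) fixcount M (t * gamma)%g = #|cycle_class n mu|%:R * h.
  move=> hh; have := @class_average _ (fixcount M) _ _ h (@fixcountJ _ M) clJ hh.
  by rewrite invgK card_permT card_ord.
have trE alpha : generates_transitive alpha gamma = ~~ preserves C alpha.
  exact: transitive_two_cycles.
rewrite (eq_bigl (fun a => (a \in cycle_class n mu) && ~~ preserves C a)) => [|a]; last by rewrite trE.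
case: hcase => [emu|hmin].
  have hsz (t : 'S_n) : t \in cycle_class n mu -> perm_eq (cycle_sizes t) [:: (n - p)%N; p].
    by rewrite cycle_classP // emu.
  have le1 : (p + (n - p) <= M.+1)%N by lia.
  have := avg _ (fun t ht => class_sum_two_eq leTN hp hpn le1 hgV (hsz t ht)).
  rewrite (bigID (preserves C)) /= !mulrDr.
  have gV : (gamma^-1)%g \in cycle_class n mu by rewrite cycle_classP // emu.
  have nz : p%:Z * ((n - p)%N%:Z *+ (p == (n - p)%N).+1) != 0.
    by rewrite mulf_neq0 ?mulrn_eq0 //=; lia.
  have := card_conj_class gV clJ nz (fun t ht => class_indicator_two_eq leTN hp hpn le1 hgV (hsz t ht)).
  rewrite card_permT card_ord => <-.
  have C0 : (0 < #|C|)%N by rewrite hxp.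
  have C1 : (#|C| < #|'I_n|)%N by rewrite hxp card_ord.
  have hgC : perm_eq (cycle_sizes gamma) [:: (#|'I_n| - #|C|)%N; #|C|] by rewrite hxp card_ord.
  have hd := disconnected_sum leTN C0 C1 gC hgC; rewrite hxp card_ord in hd.
  rewrite [edge_sum M p * _]mulrnAr -hd.
  rewrite (eq_bigl (fun t : 'S_n => perm_eq (cycle_sizes t) [:: (n - p)%N; p] && preserves C t)); last first.
    by move=> t; rewrite cycle_classP // emu.
  rewrite emu -/(two_parts n p); set S1 := \sum_(_ | _ && preserves _ _) _; set S2 := \sum_(_ | _) _.
  move=> h; apply: (addrI (p%:Z * ((n - p)%N%:Z *+ (p == (n - p)%N).+1) * #|cycle_class n (two_parts n p)|%:R * S1)).
  rewrite h -mulr_natr; ring.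
rewrite -(avg (window M p (n - p) mu)) => [|t ht].
  congr (_ * _); apply: eq_bigl => a; case ha: (a \in _) => //=.
  apply: not_preserves_long; rewrite hxp // .
  move: ha; rewrite cycle_classP // => /perm_all ->.
  by apply/allP => m /min_part_le; apply: leq_trans; rewrite -addn1.
apply: class_sum_two_gt => //.
- by rewrite -cycle_classP.
- by apply/allP => m /min_part_le; apply: leq_trans; rewrite -addn1.
- by case/and3P: hmu => _ _ /eqP ->; lia.
Qed.

(** * The genus polynomial in closed form *)
Section DifferencePolynomials.
Variable R : comNzRingType.
Implicit Types (f : {poly R}).

Definition translate (a : R) f := f \Po ('X + a%:P).

Definition poly_backdiff f (m : nat) : {poly R} := f - translate (- m%:R) f.

Definition rising_poly (q : nat) : {poly R} := \prod_(k < q) ('X + (k.+1)%:R%:P).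

Definition backdiffs_poly (q : nat) (l : seq nat) := foldl poly_backdiff (rising_poly q) l.

Definition falling_poly (p : nat) : {poly R} := \prod_(k < p) ('X - k%:R%:P).

Definition genus_numerator (p q : nat) (l : seq nat) : {poly R} :=
  \sum_(r < p) translate r%:R (falling_poly p * backdiffs_poly q l).

Lemma horner_translate a f x : (translate a f).[x] = f.[x + a].
Proof. by rewrite horner_comp !hornerE. Qed.

(** Agreement on the integers from [K] on suffices, but each difference of step [m]
costs [m] of them. *)
Lemma horner_backdiffs (f : {poly R}) (c : int -> int) (l : seq nat) (K : int) :
    (forall z, K <= z -> f.[z%:~R] = (c z)%:~R) ->
  forall z, K + (sumn l)%:Z <= z -> (foldl poly_backdiff f l).[z%:~R] = (backdiffs c l z)%:~R.
Proof.
elim: l f c K => [|m l IH] f c K h z /=; first by rewrite addr0; exact: h.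
move=> hz; apply: (IH _ _ (K + m%:Z)); last by move: hz; rewrite PoszD; lia.
move=> w hw; rewrite /poly_backdiff /backdiff !hornerE horner_translate.
rewrite h; last by lia.
have -> : w%:~R - m%:R = (w - m%:Z)%:~R :> R by rewrite rmorphB /= -pmulrn.
by rewrite h ?rmorphB //; lia.
Qed.

Lemma horner_rising q (z : int) : 0 <= z -> (rising_poly q).[z%:~R] = (rising q z)%:~R.
Proof.
move=> hz; rewrite /rising hz horner_prod rmorph_prod /=; apply: eq_bigr => k _.
by rewrite !hornerE rmorphD /= -pmulrn.
Qed.

Lemma horner_genus_numerator (p q M : nat) (l : seq nat) :
  (p <= M.+1)%N -> (sumn l <= M.+1)%N ->
  (genus_numerator p q l).[M.+1%:R] = (window M p q l)%:~R.
Proof.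
move=> hp hl; rewrite horner_sum /window.
transitivity (\sum_(r < p) (rising p ((M.+1 - p + r)%N : int) *
    backdiffs (rising q) l (M.+1%:Z + (r : nat)%:Z))%:~R : R).
  apply: eq_bigr => r _; rewrite horner_translate hornerM rmorphM /=.
  have e : M.+1%:R + (r : nat)%:R = (M.+1%:Z + (r : nat)%:Z)%:~R :> R.
    by rewrite rmorphD /= -!pmulrn.
  congr (_ * _); last first.
    by rewrite e (horner_backdiffs (K := 0) (@horner_rising q)) //; lia.
  rewrite /rising /= horner_prod rmorph_prod /= (reindex_inj rev_ord_inj) /=.
  apply: eq_bigr => k _; rewrite !hornerE e.
  have -> : ((p - k.+1)%N%:R : R) = ((p - k.+1)%N%:Z)%:~R by rewrite -pmulrn.
  rewrite -rmorphB /=; congr (_%:~R); have := ltn_ord k; lia.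
rewrite -rmorph_sum /=; congr (_%:~R).
rewrite -(big_mkord xpredT (fun r => rising p ((M.+1 - p + r)%N : int) *
    backdiffs (rising q) l (M.+1%:Z + r%:Z))).
rewrite -(big_mkord (fun i => (M.+1 <= i + p)%N) (fun i => rising p i%:Z * backdiffs (rising q) l (i%:Z + p%:Z))).
rewrite [RHS](big_cat_nat (leq0n (M.+1 - p)) (leq_subr p M.+1)) /=.
rewrite [X in _ = X + _]big_nat_cond [X in _ = X + _]big1 => [|j /andP[/andP[_ h1] h2]]; last by lia.
rewrite add0r -[X in _ = \sum_(X <= _ < _ | _) _]add0n big_addn subKn //.
rewrite big_nat_cond [RHS]big_nat_cond; apply: eq_big => [j|j /andP[/andP[_ hj] _]]; first by lia.
rewrite addnC; congr (_ * _); congr (backdiffs _ _ _); lia.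
Qed.
End DifferencePolynomials.

Lemma eq_poly_nat (F : numFieldType) (f g : {poly F}) (m0 : nat) :
  (forall m, (m0 <= m)%N -> f.[m%:R] = g.[m%:R]) -> f = g.
Proof.
move=> h; apply/eqP; rewrite -subr_eq0; apply/negP => /negP nz.
pose rs := [seq (m%:R : F) | m <- iota m0 (size (f - g))].
have : (size rs < size (f - g)%R)%N.
  apply: max_poly_roots => //.
    apply/allP => _ /mapP[m hm ->]; rewrite mem_iota in hm.
    by rewrite rootE !hornerE h ?subrr //; case/andP: hm.
  rewrite map_inj_uniq ?iota_uniq // => a b /eqP; by rewrite eqr_nat => /eqP.
by rewrite size_map size_iota ltnn.
Qed.

Lemma map_genus_numerator (R S : comNzRingType) (h : {rmorphism R -> S}) p q l :
  map_poly h (genus_numerator R p q l) = genus_numerator S p q l.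
Proof.
have hX a : map_poly h ('X + (a%:P)) = 'X + (h a)%:P.
  by rewrite rmorphD /= map_polyX map_polyC.
have ht a f : map_poly h (translate a f) = translate (h a) (map_poly h f).
  by rewrite /translate map_comp_poly hX.
rewrite /genus_numerator rmorph_sum /=; apply: eq_bigr => r _.
rewrite ht rmorph_nat rmorphM /=; congr (translate _ (_ * _)).
  rewrite rmorph_prod /=; apply: eq_bigr => k _.
  by rewrite -polyCN hX rmorphN rmorph_nat polyCN.
have h1 : map_poly h (rising_poly R q) = rising_poly S q.
  rewrite rmorph_prod /=; apply: eq_bigr => k _; by rewrite hX rmorph_nat.
rewrite /backdiffs_poly; elim: l (rising_poly R q) (rising_poly S q) h1 => [|m l IH] f g h1 //=.
by apply: IH; rewrite /poly_backdiff rmorphB /= ht h1 rmorphN rmorph_nat.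
Qed.

(** The two polynomials agree at all large integers, by [connected_sum]. *)
Lemma genus_poly_numerator n p mu (gamma : 'S_n) :
    (0 < p)%N -> (p <= n - p)%N -> gamma \in cycle_class n (two_parts n p) ->
    is_partition n mu -> mu = two_parts n p \/ (p + 1 <= min_part mu)%N ->
  genus_poly gamma mu = (n`!%:R)^-1 *: genus_numerator rat p (n - p) mu.
Proof.
move=> hp hpn hg hmu hcase.
have hgs : perm_eq (cycle_sizes gamma) [:: (n - p)%N; p].
  rewrite inE in hg; rewrite -/(two_parts n p) -(eqP hg) perm_sym perm_sort.
  by [].
have hsum : sumn mu = n by case/and3P: hmu => _ _ /eqP.
have hpos : all (leq 1) mu by case/and3P: hmu.
have hC : (0 < #|cycle_class n mu|)%N.
  have [s hs] := exists_cycle_sizes hpos; apply/card_gt0P.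
  by move: s hs; rewrite hsum => s hs; exists s; rewrite cycle_classP.
apply: (@eq_poly_nat _ _ _ n.+1) => -[|M] // hM.
have hnM : (n <= M.+1)%N by lia.
have := connected_sum hp hpn hgs hmu hcase hnM.
move/(congr1 (fun z : int => z%:~R : rat)); rewrite !rmorphM /= !mulrz_nat => h.
rewrite [RHS]hornerZ horner_genus_numerator ?hsum //; last by lia.
apply: (mulfI (x := n`!%:R)); first by rewrite pnatr_eq0 -lt0n fact_gt0.
rewrite [RHS]mulrA divff ?mul1r; last by rewrite pnatr_eq0 -lt0n fact_gt0.
have nzC : (#|cycle_class n mu|%:R : rat) != 0 by rewrite pnatr_eq0 -lt0n.
apply: (mulfI nzC); rewrite -h /genus_poly hornerZ mulrCA; congr (_ * _).
rewrite mulrA divff // mul1r horner_sum rmorph_sum /=; apply: eq_bigr => a _.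
by rewrite hornerXn fixcount_cycles /kappa mulrz_nat natrX.
Qed.

(** * Zeros on a vertical line *)
Section VerticalLine.
Variable R : rcfType.
Local Notation C := (R[i]%C).
Local Notation Re := (@complex.Re R).
Local Notation Im := (@complex.Im R).
Implicit Types (f g Q : {poly C}) (x y z : C) (c : R).

(** The square of the modulus, kept in the real field so that inequalities can be
handled by real arithmetic. *)
Definition sqmod z : R := Re z ^+ 2 + Im z ^+ 2.

Lemma sqmodM x y : sqmod (x * y) = sqmod x * sqmod y.
Proof. by case: x y => [a b] [c d]; rewrite /sqmod /=; ring. Qed.

Lemma sqmod1 : sqmod 1 = 1.
Proof. by rewrite /sqmod /= expr1n expr0n addr0. Qed.

Lemma sqmod_ge0 x : 0 <= sqmod x.
Proof. by rewrite addr_ge0 ?sqr_ge0. Qed.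

Lemma sqmod_eq0 x : (sqmod x == 0) = (x == 0).
Proof.
case: x => a b; rewrite /sqmod /= paddr_eq0 ?sqr_ge0 // !sqrf_eq0.
by rewrite eq_complex.
Qed.

Lemma sqmod_gt0 x : x != 0 -> 0 < sqmod x.
Proof. by move=> h; rewrite lt_def sqmod_ge0 sqmod_eq0 h. Qed.

Definition on_line f c := forall z, root f z -> Re z = c.

Lemma sqmod_shift_lt (rho x : C) : Re rho + 2^-1 < Re x ->
  sqmod (x - 1 - rho) < sqmod (x - rho).
Proof. by case: rho x => [a b] [d e]; rewrite /sqmod /= => h; nra. Qed.

Lemma sqmod_shift_gt (rho x : C) : Re x < Re rho + 2^-1 ->
  sqmod (x - rho) < sqmod (x - 1 - rho).
Proof. by case: rho x => [a b] [d e]; rewrite /sqmod /= => h; nra. Qed.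

(** The zeros of [Q] have real part [c] and those of its translate real part
[c + 1].  A point on one side of the middle line is closer to each zero of the one
polynomial than to the corresponding zero of the other. *)
Lemma on_line_compare Q c x : Q != 0 -> on_line Q c ->
  (c + 2^-1 < Re x -> sqmod Q.[x - 1] <= sqmod Q.[x] /\
     ((1 < size Q)%N -> sqmod Q.[x - 1] < sqmod Q.[x])) /\
  (Re x < c + 2^-1 -> sqmod Q.[x] <= sqmod Q.[x - 1] /\
     ((1 < size Q)%N -> sqmod Q.[x] < sqmod Q.[x - 1])).
Proof.
move=> nzQ hQ; have [r er] := closed_field_poly_normal Q.
have hr : all (fun rho => Re rho == c) r.
  apply/allP => rho hrho; apply/eqP/hQ; rewrite er rootZ ?lead_coef_eq0 //.
  by rewrite root_prod_XsubC.
have hl : 0 < sqmod (lead_coef Q) by rewrite sqmod_gt0 // lead_coef_eq0.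
have hsz : (1 < size Q)%N = (r != [::]).
  by rewrite er size_scale ?lead_coef_eq0 // size_prod_XsubC; case: (r).
have hor y : sqmod Q.[y] = sqmod (lead_coef Q) * \prod_(rho <- r) sqmod (y - rho).
  rewrite {1}er hornerZ sqmodM; congr (_ * _); rewrite horner_prod.
  elim: (r) => [|a l IH]; first by rewrite !big_nil sqmod1.
  by rewrite !big_cons sqmodM IH !hornerE.
have main (u v : C) : (forall rho, Re rho = c -> sqmod (u - rho) < sqmod (v - rho)) ->
    sqmod Q.[u] <= sqmod Q.[v] /\ ((1 < size Q)%N -> sqmod Q.[u] < sqmod Q.[v]).
  move=> h; rewrite !hor hsz ler_pM2l // ltr_pM2l //.
  have hall l : all (fun rho => Re rho == c) l ->
     \prod_(rho <- l) sqmod (u - rho) <= \prod_(rho <- l) sqmod (v - rho)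
     /\ 0 < \prod_(rho <- l) sqmod (v - rho).
    elim: l => [|a l IH] /=; first by rewrite !big_nil.
    case/andP => /eqP ha /IH[h1 h2]; rewrite !big_cons.
    have h3 := h _ ha; have h4 := sqmod_ge0 (u - a); split.
      by apply: ler_pM => //; [apply: prodr_ge0 => i _; exact: sqmod_ge0 | exact: ltW].
    by apply: mulr_gt0 => //; exact: le_lt_trans h4 h3.
  split; first by case: (hall r hr).
  case: (r) hr => // a l /= /andP[/eqP ha /hall[h1 h2]] _; rewrite !big_cons.
  apply: le_lt_trans (_ : sqmod (u - a) * \prod_(rho <- l) sqmod (v - rho) < _).
    by apply: ler_wpM2l => //; exact: sqmod_ge0.
  by rewrite ltr_pM2r //; exact: h.
split=> hx; apply: main => rho hrho.
  by apply: sqmod_shift_lt; rewrite hrho.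
by apply: sqmod_shift_gt; rewrite hrho.
Qed.

Definition real (c : R) : C := Complex c 0.

(** The monic polynomial with [L] consecutive real zeros centred at [c]. *)
Definition run (L : nat) c : {poly C} :=
  \prod_(k < L) ('X - (real (c - (L%:R - 1) / 2 + k%:R))%:P).

Definition aligned f (L : nat) c := exists Q, f = run L c * Q /\ on_line Q c.

Definition step (theta : C) f := f - theta *: translate (-1) f.

Lemma realB a b : real (a - b) = real a - real b.
Proof. by apply/eqP; rewrite eq_complex /= subr0 !eqxx. Qed.

Lemma translate_XsubC (a : C) (b : C) : translate a ('X - b%:P) = 'X - (b - a)%:P.
Proof. by rewrite /translate comp_polyB comp_polyX comp_polyC polyCB opprB addrA. Qed.

Lemma translateM a f g : translate a (f * g) = translate a f * translate a g.
Proof. exact: comp_polyM. Qed.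

Lemma translate_run a L c : translate (real a) (run L c) = run L (c - a).
Proof.
rewrite /translate /run rmorph_prod /=; apply: eq_bigr => k _.
rewrite -/(translate _ _) translate_XsubC -realB; congr ('X - (real _)%:P); ring.
Qed.

Lemma run_recl L c :
  run L.+1 c = ('X - (real (c - L%:R / 2))%:P) * run L (c + 2^-1).
Proof.
have eS m : (m.+1%:R : R) = m%:R + 1 by rewrite -addn1 natrD.
rewrite /run big_ord_recl; congr (_ * _).
  by congr ('X - (real _)%:P); rewrite eS /=; field.
apply: eq_bigr => k _; congr ('X - (real _)%:P).
by rewrite /= /bump /= add1n !eS; field.
Qed.

Lemma run_recr L c :
  run L.+1 (c + 1) = run L (c + 2^-1) * ('X - (real (c + L%:R / 2 + 1))%:P).
Proof.
have eS m : (m.+1%:R : R) = m%:R + 1 by rewrite -addn1 natrD.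
rewrite /run big_ord_recr; congr (_ * _).
  apply: eq_bigr => k _; congr ('X - (real _)%:P).
  by rewrite /= eS; field.
by congr ('X - (real _)%:P); rewrite /= eS; field.
Qed.

(** [run L c] and its translate by 1 share [L - 1] zeros, which form the new run;
the remaining zero of each lies at the same distance on either side of the line
[Re x = c + 1/2].  So on either side of this line the two terms that are left have
different moduli, by [on_line_compare], and cannot cancel.  If there is no run, then
the comparison is strict only for a non-constant [f]; a constant [f] gives a
non-zero constant. *)
Lemma aligned_step theta f L c : sqmod theta = 1 -> aligned f L c ->
  step theta f != 0 -> aligned (step theta f) L.-1 (c + 2^-1).
Proof.
move=> ht [Q [ef hQ]] nz.
have nzQ : Q != 0.
  by apply: contraNneq nz => e; rewrite /step ef e mulr0 /translate comp_poly0 scaler0 subrr.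
have e1 : -1 = real (-1) by apply/eqP; rewrite eq_complex /= oppr0 !eqxx.
case: L ef => [|L] ef.
  exists (step theta f); split; first by rewrite /run big_ord0 mul1r.
  rewrite /run big_ord0 mul1r in ef; rewrite ef in nz * => x.
  case: (leqP (size Q) 1) => hsz.
    rewrite (size1_polyC hsz) /step /translate comp_polyC -mul_polyC -polyCM -polyCB in nz *.
    by rewrite rootC -polyC_eq0 (negbTE nz).
  rewrite rootE /step !hornerE horner_translate subr_eq0 => /eqP /(congr1 sqmod).
  rewrite sqmodM ht mul1r => e.
  have [h1 h2] := on_line_compare x nzQ hQ.
  case: (ltrgtP (c + 2^-1) (Re x)) => // hx.
    by have [_ /(_ hsz)] := h1 hx; rewrite e ltxx.
  by have [_ /(_ hsz)] := h2 hx; rewrite e ltxx.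
pose Q' := ('X - (real (c - L%:R / 2))%:P) * Q -
   theta *: (('X - (real (c + L%:R / 2 + 1))%:P) * translate (-1) Q).
exists Q'; split.
  rewrite /step ef translateM e1 translate_run opprK run_recr run_recl /Q' -e1.
  by rewrite -!mul_polyC; ring.
move=> x; rewrite rootE /Q' !hornerE horner_translate subr_eq0 => /eqP /(congr1 sqmod).
rewrite !sqmodM ht mul1r => e.
have [h1 h2] := on_line_compare x nzQ hQ.
have far (b : R) : sqmod (x - real b) = (Re x - b) ^+ 2 + Im x ^+ 2.
  by case: x {e h1 h2} => u v; rewrite /sqmod /= subr0.
have L0 : 0 <= (L%:R : R) by rewrite ler0n.
case: (ltrgtP (c + 2^-1) (Re x)) => // hx.
  have [h3 _] := h1 hx.
  have h4 : 0 < sqmod Q.[x].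
    rewrite sqmod_gt0 //; apply/negP => /eqP hr; have := hQ x; rewrite rootE hr eqxx => /(_ isT).
    by move=> hc; move: hx; rewrite hc; lra.
  have h5 : sqmod (x - real (c + L%:R / 2 + 1)) < sqmod (x - real (c - L%:R / 2)).
    by rewrite !far; nra.
  have h6 := sqmod_ge0 (x - real (c + L%:R / 2 + 1)).
  have : sqmod (x - real (c + L%:R / 2 + 1)) * sqmod Q.[x - 1] <
     sqmod (x - real (c - L%:R / 2)) * sqmod Q.[x].
    apply: le_lt_trans (ler_wpM2l h6 h3) _; by rewrite ltr_pM2r.
  by rewrite e ltxx.
have [h3 _] := h2 hx.
have h4 : 0 < sqmod Q.[x - 1].
  rewrite sqmod_gt0 //; apply/negP => /eqP hr; have := hQ (x - 1); rewrite rootE hr eqxx => /(_ isT).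
  case: x hx {e h1 h2 far h3 hr} => u v /= hx; lra.
have h5 : sqmod (x - real (c - L%:R / 2)) < sqmod (x - real (c + L%:R / 2 + 1)).
  by rewrite !far; nra.
have h6 := sqmod_ge0 (x - real (c - L%:R / 2)).
have : sqmod (x - real (c - L%:R / 2)) * sqmod Q.[x] <
   sqmod (x - real (c + L%:R / 2 + 1)) * sqmod Q.[x - 1].
  apply: le_lt_trans (ler_wpM2l h6 h3) _; by rewrite ltr_pM2r.
by rewrite e ltxx.
Qed.
End VerticalLine.

(** * Polynomials in the shift operator *)
Section Operators.
Variable R : rcfType.
Local Notation C := (R[i]%C).
Implicit Types (f g Q : {poly C}) (c : R).

Lemma translate_translate (a b : C) f : translate a (translate b f) = translate (a + b) f.
Proof.
rewrite /translate -comp_polyA; congr (f \Po _).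
by rewrite comp_polyD comp_polyX comp_polyC -addrA -polyCD.
Qed.

(** [g(E) f], where [E] is the translation that sends [f(x)] to [f(x - 1)]. *)
Definition shift_op g f := \sum_(i < size g) g`_i *: translate (- i%:R) f.

Lemma shift_op_widen (B : nat) g f : (size g <= B)%N ->
  shift_op g f = \sum_(i < B) g`_i *: translate (- i%:R) f.
Proof.
move=> h; rewrite /shift_op (big_ord_widen B (fun i => g`_i *: translate (- i%:R) f) h).
rewrite big_mkcond; apply: eq_bigr => i _; case: ltnP => // hi.
by rewrite nth_default // scale0r.
Qed.

Lemma shift_op_mulX g f : shift_op (g * 'X) f = translate (-1) (shift_op g f).
Proof.
have h : (size (g * 'X)%R <= (size g).+1)%N.
  by apply: leq_trans (size_polyMleq _ _) _; rewrite size_polyX addn2.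
rewrite (shift_op_widen f h) big_ord_recl coefMX scale0r add0r.
rewrite /shift_op [translate _ (\sum_(_ < _) _)]raddf_sum /=.
apply: eq_bigr => i _; rewrite coefMX /= {2}/translate linearZ /=; congr (_ *: _).
by rewrite -/(translate _ _) translate_translate -opprD /bump /= add1n -natr1 addrC.
Qed.

Lemma shift_op_step theta g f :
  shift_op ((1 - theta *: 'X) * g) f = step theta (shift_op g f).
Proof.
rewrite /step -shift_op_mulX mulrBl mul1r -scalerAl ['X * g]mulrC.
have h2 : (size (g * 'X)%R <= (size g).+1)%N.
  by apply: leq_trans (size_polyMleq _ _) _; rewrite size_polyX addn2.
have h1 : (size g <= (size g).+1)%N by [].
have h3 : (size (g - theta *: (g * 'X))%R <= (size g).+1)%N.
  apply: leq_trans (size_polyD _ _) _; rewrite geq_max h1 size_polyN.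
  exact: leq_trans (size_scale_leq _ _) h2.
rewrite (shift_op_widen f h1) (shift_op_widen f h2) (shift_op_widen f h3).
rewrite scaler_sumr -sumrB; apply: eq_bigr => i _.
by rewrite coefB coefZ scalerBl scalerA.
Qed.

(** A root [z] of [g] is not 0, and [X - z] is a multiple of [1 - z^-1 X]; the constant
coefficient shows that the multiples cancel. *)
Lemma unit_circle_factors g : g`_0 = 1 -> (forall z, root g z -> sqmod z = 1) ->
  exists rs : seq C, [/\ all (fun z => sqmod z == 1) rs, size rs = (size g).-1 &
    g = \prod_(z <- rs) (1 - z *: 'X)].
Proof.
move=> g0 hg; have [r er] := closed_field_poly_normal g.
have nzg : g != 0 by apply/eqP => e; move/eqP: g0; rewrite e coef0 eq_sym oner_eq0.
have hr : all (fun z => sqmod z == 1) r.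
  apply/allP => z hz; apply/eqP/hg; rewrite er rootZ ?lead_coef_eq0 //.
  by rewrite root_prod_XsubC.
exists (map (fun z => z^-1) r); split.
- rewrite all_map; apply/allP => z hz /=; have /eqP h := allP hr z hz.
  have nz : z != 0 by rewrite -sqmod_eq0 h oner_eq0.
  have : sqmod (z * z^-1) = 1 by rewrite divff // sqmod1.
  by rewrite sqmodM h mul1r => ->.
- by rewrite size_map er size_scale ?lead_coef_eq0 // size_prod_XsubC.
rewrite big_map.
have e2 : \prod_(z <- r) ('X - z%:P) = (\prod_(z <- r) - z) *: \prod_(z <- r) (1 - z^-1 *: 'X).
  rewrite -scaler_prod !big_seq; apply: eq_bigr => z hz.
  have /eqP h := allP hr z hz.
  have nz : z != 0 by rewrite -sqmod_eq0 h oner_eq0.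
  by rewrite scalerBr scalerA mulNr divff // scaleN1r opprK addrC scaleNr alg_polyC.
rewrite er e2 scalerA in g0 *; move: g0; rewrite coefZ.
have -> : (\prod_(z <- r) (1 - z^-1 *: 'X))`_0 = 1 :> C.
  rewrite -horner_coef0 horner_prod big1 // => z _.
  by rewrite !hornerE ?mulr0 ?subr0.
by rewrite mulr1 => ->; rewrite scale1r.
Qed.

(** Apply [aligned_step] once for each linear factor of [g].  The intermediate
polynomials are not 0, because the last one is not. *)
Lemma aligned_shift_op g f L c : g`_0 = 1 -> (forall z, root g z -> sqmod z = 1) ->
  aligned f L c -> shift_op g f != 0 ->
  aligned (shift_op g f) (L - (size g).-1) (c + (size g).-1%:R / 2).
Proof.
move=> g0 hg hf; have [rs [hrs hsz eg]] := unit_circle_factors g0 hg.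
rewrite -hsz {}eg {hsz}; elim: rs hrs => [|z rs IH] /=.
  rewrite big_nil /shift_op size_poly1 big_ord1 coef1 /= scale1r oppr0.
  by rewrite /translate addr0 comp_polyXr subn0 mul0r addr0.
case/andP => /eqP hz hrs; rewrite big_cons shift_op_step => nz.
have nz' : shift_op (\prod_(z <- rs) (1 - z *: 'X)) f != 0.
  by apply: contraNneq nz => ->; rewrite /step /translate comp_poly0 scaler0 subrr.
have := aligned_step hz (IH hrs nz') nz.
rewrite -subnS; congr (aligned _ _ _).
by rewrite -[(size rs).+1]addn1 natrD; field.
Qed.
End Operators.

(** * The numerator is not zero *)
Section Nonvanishing.
Variable F : numFieldType.
Implicit Types f g : {poly F}.

Lemma size_translate a f : size (translate a f) = size f.
Proof. by apply: size_comp_poly2; rewrite size_XaddC. Qed.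

Lemma lead_coef_translate a f : lead_coef (translate a f) = lead_coef f.
Proof. by rewrite lead_coef_comp ?size_XaddC // lead_coefXaddC expr1n mulr1. Qed.

Lemma ltn_size_deriv k f : (k.+1 < size f)%N -> (k < size f^`())%N.
Proof.
case e : (size f) => [|[|n]] //; rewrite ltnS => hk; apply: leq_trans hk _.
rewrite ltnNge; apply/negP => /(nth_default 0)/eqP.
rewrite coef_deriv mulrn_eq0 /= (_ : f`_n.+1 = lead_coef f); last by rewrite lead_coefE e.
by rewrite lead_coef_eq0 -size_poly_eq0 e.
Qed.

Lemma deriv_backdiff m f : (poly_backdiff f m)^`() = poly_backdiff f^`() m.
Proof. by rewrite /poly_backdiff derivB deriv_comp derivD derivX derivC addr0 mulr1. Qed.

(** Differences commute with derivatives, which reduces the claim to polynomials of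
degree 1. *)
Lemma backdiff_neq0 m f : (0 < m)%N -> (1 < size f)%N -> poly_backdiff f m != 0.
Proof.
move=> hm; have [d] := ubnP (size f); elim: d f => // d IH f hd hf.
case: (ltnP 2 (size f)) => hf2.
  have nzf : f != 0 by rewrite -size_poly_gt0; lia.
  have h1 := ltn_size_deriv hf2.
  have h2 := lt_size_deriv nzf.
  have : poly_backdiff f^`() m != 0 by apply: IH => //; lia.
  by rewrite -deriv_backdiff; apply: contraNneq => ->; rewrite deriv0.
have e : size f = 2%N by lia.
apply/eqP => /(congr1 (fun g => g.[0])).
rewrite /poly_backdiff !hornerE horner_translate !horner_coef e !big_ord_recl !big_ord0 /=.
rewrite /bump /= add0r !expr0 !expr1 !mulr1 !addr0 mulr0 addr0 mulrN opprD opprK addrA subrr add0r.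
move/eqP; rewrite mulf_eq0 pnatr_eq0 (gtn_eqF hm) orbF.
have -> : f`_1 = lead_coef f by rewrite lead_coefE e.
by rewrite lead_coef_eq0 -size_poly_eq0 e.
Qed.

Lemma ltn_size_backdiff k m f : (0 < m)%N -> (k.+1 < size f)%N -> (k < size (poly_backdiff f m))%N.
Proof.
move=> hm; elim: k f => [|k IH] f hf.
  by rewrite size_poly_gt0 backdiff_neq0.
have h := IH _ (ltn_size_deriv hf); rewrite -deriv_backdiff in h.
apply: leq_ltn_trans h (lt_size_deriv _); apply: backdiff_neq0 => //; lia.
Qed.

(** Each difference lowers the degree by exactly 1. *)
Lemma backdiffs_neq0 (l : seq nat) f : all (leq 1) l -> (size l < size f)%N ->
  foldl (@poly_backdiff F) f l != 0.
Proof.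
elim: l f => [|m l IH] f /=; first by rewrite size_poly_gt0.
by case/andP => hm hl hf; apply: IH => //; apply: ltn_size_backdiff.
Qed.

Lemma size_rising_poly q : size (rising_poly F q) = q.+1.
Proof.
rewrite /rising_poly (eq_bigr (fun k : 'I_q => 'X - (- (k.+1)%:R)%:P)) => [|k _].
  by rewrite size_prod_XsubC /index_enum -enumT size_enum_ord.
by rewrite polyCN opprK.
Qed.

(** The [p] translates have the same leading coefficient. *)
Lemma genus_numerator_neq0 p q (l : seq nat) : (0 < p)%N -> all (leq 1) l ->
  (size l <= q)%N -> genus_numerator F p q l != 0.
Proof.
move=> hp hl hq; set G := falling_poly F p * backdiffs_poly F q l.
have nzG : G != 0.
  rewrite mulf_neq0 //; last by apply: backdiffs_neq0; rewrite ?size_rising_poly.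
  by apply/prodf_neq0 => k _; rewrite polyXsubC_eq0.
apply/eqP => /(congr1 (fun h : {poly F} => h`_(size G).-1)); rewrite coef0 /genus_numerator coef_sum -/G.
rewrite (eq_bigr (fun=> lead_coef G)) => [|r _]; last first.
  by rewrite -[in LHS](size_translate r%:R G) -lead_coefE lead_coef_translate.
move/eqP; rewrite sumr_const card_ord mulrn_eq0 lead_coef_eq0 (negbTE nzG) orbF.
by rewrite (gtn_eqF hp).
Qed.
End Nonvanishing.

(** * Location of the zeros *)
Section Zeros.
Variable R : rcfType.
Local Notation C := (R[i]%C).
Implicit Types (f g Q : {poly C}) (c : R).

Lemma sqmodX (z : C) m : sqmod (z ^+ m) = sqmod z ^+ m.
Proof. by elim: m => [|m IH]; rewrite ?expr0 ?sqmod1 // !exprS sqmodM IH. Qed.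

Lemma sqmod_unity (z : C) m : (0 < m)%N -> z ^+ m = 1 -> sqmod z = 1.
Proof.
move=> hm /(congr1 (@sqmod R)); rewrite sqmodX sqmod1 => /eqP.
by rewrite pexpr_eq1 ?sqmod_ge0 // => /eqP.
Qed.

Lemma backdiff_shift_op m f : (0 < m)%N -> poly_backdiff f m = shift_op (1 - 'X^m) f.
Proof.
case: m => // m _.
have h : (size (1 - 'X^(m.+1) : {poly C})%R <= m.+2)%N.
  apply: leq_trans (size_polyD _ _) _.
  by rewrite size_polyN size_polyXn size_poly1 geq_max leqnn.
rewrite (shift_op_widen f h) big_ord_recl big_ord_recr /= big1 => [|k _].
  rewrite !coefB !coef1 !coefXn /= /bump /= add1n eqxx subr0 sub0r scale1r scaleN1r add0r.
  by rewrite /poly_backdiff oppr0 {2}/translate addr0 comp_polyXr.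
rewrite coefB coef1 coefXn /= /bump /= add1n eqSS (ltn_eqF (ltn_ord k)) subrr.
by rewrite scale0r.
Qed.

Lemma aligned_backdiff m f L c : (0 < m)%N -> aligned f L c -> poly_backdiff f m != 0 ->
  aligned (poly_backdiff f m) (L - m) (c + m%:R / 2).
Proof.
move=> hm hf; rewrite backdiff_shift_op // => nz.
have hs : size (1 - 'X^m : {poly C}) = m.+1.
  by rewrite -opprB size_polyN size_XnsubC.
have := aligned_shift_op _ _ hf nz; rewrite hs /=; apply.
  by rewrite coefB coef1 coefXn /= (ltn_eqF hm) subr0.
move=> z; rewrite rootE !hornerE ?hornerXn subr_eq0 => /eqP h.
exact: (sqmod_unity hm (esym h)).
Qed.

Lemma aligned_backdiffs (l : seq nat) f L c : all (leq 1) l -> aligned f L c ->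
  foldl (@poly_backdiff C) f l != 0 ->
  aligned (foldl (@poly_backdiff C) f l) (L - sumn l) (c + (sumn l)%:R / 2).
Proof.
elim: l f L c => [|m l IH] f L c /=; first by rewrite subn0 mul0r addr0.
case/andP => hm hl hf nz.
have f0 k : foldl (@poly_backdiff C) 0 k = 0.
  elim: k => //= j k IHk; rewrite (_ : poly_backdiff 0 j = 0) //.
  by rewrite /poly_backdiff /translate comp_poly0 subrr.
have nz1 : poly_backdiff f m != 0 by apply: contraNneq nz => ->; rewrite f0.
have := IH _ _ _ hl (aligned_backdiff hm hf nz1) nz.
rewrite subnDA; congr (aligned _ _ _).
by rewrite natrD; field.
Qed.

Lemma real_nat m : real m%:R = m%:R :> C.
Proof.
elim: m => [|m IH]; first by apply/eqP; rewrite eq_complex /= !eqxx.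
by rewrite -[in RHS]natr1 -IH; apply/eqP; rewrite eq_complex /= -natr1 addr0 !eqxx.
Qed.

Lemma realN a : real (- a) = - real a :> C.
Proof. by apply/eqP; rewrite eq_complex /= oppr0 !eqxx. Qed.

Lemma aligned_rising q : aligned (rising_poly C q) q (- (q%:R + 1) / 2).
Proof.
exists 1; split; last by move=> z; rewrite rootE hornerC oner_eq0.
rewrite mulr1 /run (reindex_inj rev_ord_inj) /=; apply: eq_bigr => k _.
rewrite -[(k.+1)%:R%:P]opprK -polyCN -real_nat -realN; congr ('X - (real _)%:P).
by rewrite natrB ?ltn_ord // -natr1; field.
Qed.

(** The run of [rising_poly] is used up by the differences, leaving the line
[Re x = (p - 1)/2].  This is the centre of the zeros of [falling_poly], which supply
a new run of length [p]; the final sum of [p] translates shortens it to the single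
zero 0. *)
Lemma genus_numerator_zeros p q (l : seq nat) (z : C) :
    (0 < p)%N -> (p <= q)%N -> all (leq 1) l -> sumn l = (p + q)%N -> (size l <= q)%N ->
  root (genus_numerator C p q l) z -> complex.Re z = 0.
Proof.
move=> hp hpq hl hsum hsz.
have nzW := genus_numerator_neq0 C hp hl hsz.
have nzB : backdiffs_poly C q l != 0.
  by apply: backdiffs_neq0 => //; rewrite size_rising_poly.
have hB := aligned_backdiffs hl (aligned_rising q) nzB.
pose G := falling_poly C p * backdiffs_poly C q l.
have hG : aligned G p ((p%:R - 1) / 2).
  have [Q [eQ hQ]] := hB; exists (backdiffs_poly C q l); split.
    congr (_ * _); rewrite /falling_poly /run; apply: eq_bigr => k _.
    by rewrite -real_nat; congr ('X - (real _)%:P); field.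
  move: eQ; rewrite hsum (_ : q - (p + q) = 0)%N; last by lia.
  rewrite /run big_ord0 mul1r -/(backdiffs_poly C q l) => ->.
  move: hQ; rewrite hsum natrD (_ : - (q%:R + 1) / 2 + (p%:R + q%:R) / 2 = (p%:R - 1) / 2) //.
  by field.
have hGt : aligned (translate (p.-1)%:R G) p (- (p%:R - 1) / 2).
  have [Q [eQ hQ]] := hG; exists (translate (p.-1)%:R Q); split.
    rewrite eQ translateM -real_nat translate_run; congr (run p _ * _).
    by rewrite -[in p%:R](prednK hp) -natr1; field.
  move=> x; rewrite rootE horner_translate => /hQ.
  rewrite -real_nat; case: x => u v /= hu.
  apply: (addIr (p.-1%:R)); rewrite hu -[in p%:R](prednK hp) -natr1; by field.
(* The sum over [r < p] is [1 + E + ... + E^(p - 1)], applied after a translation by [p - 1]. *)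
pose U : {poly C} := \poly_(i < p) 1.
have hU : size U = p by rewrite size_poly_eq ?oner_eq0.
have eW : genus_numerator C p q l = shift_op U (translate (p.-1)%:R G).
  rewrite /shift_op hU /genus_numerator (reindex_inj rev_ord_inj) /=.
  apply: eq_bigr => r _; rewrite coef_poly ltn_ord scale1r translate_translate.
  congr (translate _ _); rewrite natrB ?ltn_ord // -(natr1 r).
  by rewrite -[in p%:R](prednK hp) -natr1; ring.
rewrite eW in nzW; rewrite eW.
have U0 : U`_0 = 1 by rewrite coef_poly hp.
have Uroot x : root U x -> sqmod x = 1.
  rewrite rootE => /eqP h; apply: (sqmod_unity hp); apply/eqP; rewrite -subr_eq0 subrX1.
  move: h; rewrite /U poly_def horner_sum => h.
  rewrite (eq_bigr (fun i : 'I_p => (1 *: 'X^i : {poly C}).[x])) ?h ?mulr0 // => i _.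
  by rewrite scale1r hornerXn.
have [Q [eQ hQ]] := aligned_shift_op U0 Uroot hGt nzW.
rewrite eQ hU rootM (_ : p - p.-1 = 1)%N; last by lia.
have e0 : - (p%:R - 1) / 2 + p.-1%:R / 2 = 0 :> R.
  by rewrite -[in p%:R](prednK hp) -natr1; field.
rewrite hU e0 in hQ *.
case/orP; last exact: hQ.
rewrite /run big_ord1 root_XsubC => /eqP ->.
by rewrite /= add0r subrr mul0r oppr0 addr0.
Qed.
End Zeros.

Lemma size_le_sumn (p : nat) (l : seq nat) : all (leq p.+1) l ->
  (p.+1 * size l <= sumn l)%N.
Proof. by elim: l => [|m l IH] /=; [rewrite muln0 | case/andP => hm /IH; rewrite mulnS; lia]. Qed.

Local Close Scope ring_scope.

Theorem theorem4p4 (R : realType) (n p : nat) (mu : seq nat) (gamma : 'S_n)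
    (hp : 0 < p) (hpn : p <= n - p)
    (hgamma : gamma \in cycle_class n (two_parts n p))
    (hmu : is_partition n mu)
    (hcase : mu = two_parts n p \/ p + 1 <= min_part mu)
    (* for n = 2 and mu = [1,1] the polynomial is identically zero *)
    (hdeg : mu <> [:: 1; 1])
    (z : R[i]%C)
    (hz : root (map_poly (@ratr _) (genus_poly gamma mu)) z) :
  complex.Re z = 0%R.
Proof.
have hpos : all (leq 1) mu by case/and3P: hmu.
have hsum : sumn mu = n by case/and3P: hmu => _ _ /eqP.
(* The number of differences may not exceed the degree of [rising_poly];
   this is what fails for [mu = [1, 1]]. *)
have hsize : (size mu <= n - p)%N.
  case: hcase => [e|hmin].
    rewrite e /=; have [//|h] := leqP 2 (n - p).
    case: hdeg; rewrite e /two_parts.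
    by have [-> ->] : (n - p = 1 /\ p = 1)%N by lia.
  have h : all (leq p.+1) mu.
    by apply/allP => m /min_part_le; apply: leq_trans; rewrite -addn1.
  have := size_le_sumn h; rewrite hsum; nia.
rewrite (genus_poly_numerator hp hpn hgamma hmu hcase) map_polyZ rootZ in hz; last first.
  by rewrite fmorphV invr_eq0 rmorph_nat pnatr_eq0 -lt0n fact_gt0.
rewrite map_genus_numerator in hz.
have hpq : sumn mu = p + (n - p) by rewrite hsum; lia.
exact: genus_numerator_zeros hp hpn hpos hpq hsize hz.
Qed.
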